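(* Let $\mathbb{K}$ be an algebraically closed field of characteristic $p>0$ and let $\mathfrak{l}$ be a restricted Lie algebra or a restricted Lie superalgebra over $\mathbb{K}$ (in the superalgebra case, with center $C(\mathfrak{l})\subseteq\mathfrak{l}_{\bar 0}$). Let $\mathfrak{g}=\mathfrak{l}\otimes\mathbb{K}[x]$ (with $\mathbb{I}=\mathbb{N}$) or $\mathfrak{g}=\mathfrak{l}\otimes\mathbb{K}[x,x^{-1}]$ (with $\mathbb{I}=\mathbb{Z}$) be the current or loop (super)algebra of $\mathfrak{l}$. Let $\{e_i\mid i\in I\}$ be a basis of $\mathfrak{l}$ such that $\{e_j\mid j\in J\}$, $J\subseteq I$, is a basis of $C(\mathfrak{l})$; in the superalgebra case assume moreover that $I=I_0\sqcup I_1$, where $\{e_k\mid k\in I_0\}$ is a basis of $\mathfrak{l}_{\bar 0}$, $\{e_l\mid l\in I_1\}$ is a basis of $\mathfrak{l}_{\bar 1}$, and $J\subseteq I_0$. Put $e_{ir}=e_i\otimes x^r$ for $i\in I$, $r\in\mathbb{I}$. Then the center $Z(\mathfrak{g})$ of $U(\mathfrak{g})$ is generated by $\{e_{jr}\mid j\in J, r\in\mathbb{I}\}$ and the $p$-center $Z_p(\mathfrak{g})$. More precisely: (1) If $\mathfrak{l}$ is a Lie algebra, then $Z(\mathfrak{g})$ is freely generated by $$\{e_{jr}\mid j\in J, r\in\mathbb{I}\}\cup\{e_{ir}^p-e_{ir}^{[p]}\mid i\in I\setminus J, r\in\mathbb{I}\}.$$ (2) If $\mathfrak{l}$ is a Lie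 superalgebra, then $Z(\mathfrak{g})$ is freely generated by $$\{e_{jr}\mid j\in J, r\in\mathbb{I}\}\cup\{e_{ir}^p-e_{ir}^{[p]}\mid i\in I_0\setminus J, r\in\mathbb{I}\}.$$
   Context: The current (super)algebra $\mathfrak{l}[x]=\mathfrak{l}\otimes\mathbb{K}[x]$ and the loop (super)algebra $\mathfrak{l}(x)=\mathfrak{l}\otimes\mathbb{K}[x,x^{-1}]$ have bracket $[e\otimes x^r,f\otimes x^s]=[e,f]\otimes x^{r+s}$ for $e,f\in\mathfrak{l}$ and $r,s\in\mathbb{N}$ (resp. $r,s\in\mathbb{Z}$), where $\mathbb{N}$ includes $0$; in the super case the $\mathbb{Z}_2$-grading is $|e\otimes x^r|=|e|$. $C(\mathfrak{l})=\{z\in\mathfrak{l}\mid [z,y]=0\ \forall y\in\mathfrak{l}\}$. $U(\mathfrak{g})$ is the universal enveloping (super)algebra, and $Z(\mathfrak{g})=\{z\in U(\mathfrak{g})\mid [z,u]=0\ \forall u\in U(\mathfrak{g})\}$, where $[z,u]=zu-uz$ in the Lie algebra case and $[z,u]=zu-(-1)^{|z||u|}uz$ (for homogeneous elements, extended bilinearly) in the superalgebra case. A restricted Lie superalgebra is one whose even part is a restricted Lie algebra with $p$-th power map $y\mapsto y^{[p]}$ and $(\operatorname{ad} y)^p=\operatorname{ad}(y^{[p]})$ on the whole superalgebra for even $y$. The restricted structure on $\mathfrak{l}$ induces one on $\mathfrak{g}$, determined by $(e_i\otimes x^r)^{[p]}=e_i^{[p]}\otimes x^{rp}$ for all $r\in\mathbb{I}$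 and all $i\in I$ ($i\in I_0$ in the super case). The $p$-center $Z_p(\mathfrak{g})$ is the subalgebra of $Z(\mathfrak{g})$ generated by all $y^p-y^{[p]}$ with $y\in\mathfrak{g}$ (with $y\in\mathfrak{g}_{\bar 0}$ in the super case), where $y^p$ is the $p$-th power in $U(\mathfrak{g})$. ''Freely generated'' means that the given elements generate the algebra as a commutative $\mathbb{K}$-algebra and are algebraically independent. *)

(* Defs.v *)
From HB Require Import structures.
From mathcomp Require Import all_boot all_order all_algebra finmap ring.
From mathcomp.multinomials Require Import monalg.
From mathcomp.multinomials Require mpoly.

Set Implicit Arguments.
Unset Strict Implicit.
Unset Printing Implicit Defensive.

Import GRing.Theory.
Local Open Scope ring_scope.

(* The tensor product l (x) K[S] for a commutative monoid S: the finitely supported functions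
   S -> l. The element v (x) x^r is << v *g r >>, and u@_r is the coefficient
   of x^r in u. *)
Definition current (K : fieldType) (S : nmodType) (l : lmodType K) : Type :=
  {malg l[S]}.

Section CurrentModule.
Context (K : fieldType) (S : nmodType) (l : lmodType K).

HB.instance Definition _ := GRing.Zmodule.on (current S l).

Definition cscale (a : K) (u : current S l) : current S l :=
  [malg r in msupp u => a *: u@_r].

Lemma cscaleE a u r : (cscale a u)@_r = a *: u@_r.
Proof. by rewrite mcoeffE; case: msuppP; rewrite ?scaler0. Qed.

Lemma cscaleA a b u : cscale a (cscale b u) = cscale (a * b) u.
Proof. by apply/malgP => r; rewrite !cscaleE scalerA. Qed.

Lemma cscale1 : left_id 1 cscale.
Proof. by move=> u; apply/malgP => r; rewrite cscaleE scale1r. Qed.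

Lemma cscaleDr : right_distributive cscale +%R.
Proof.
by move=> a u v; apply/malgP => r; rewrite !(mcoeffD, cscaleE) scalerDr.
Qed.

Lemma cscaleDl u : {morph cscale^~ u : a b / a + b}.
Proof.
by move=> a b; apply/malgP => r; rewrite !(mcoeffD, cscaleE) scalerDl.
Qed.

HB.instance Definition _ :=
  GRing.Zmodule_isLmodule.Build K (current S l)
    cscaleA cscale1 cscaleDr cscaleDl.

End CurrentModule.

Section CurrentOperations.
Context (K : fieldType) (S : nmodType) (l : lmodType K).
Implicit Types (br : l -> l -> l) (u v : current S l).

Definition cbr br u v : current S l :=
  \sum_(r <- msupp u) \sum_(s <- msupp v) << br u@_r v@_s *g r + s >>.

Definition cpar (par : bool -> l -> Prop) (a : bool) u : Prop :=
  forall r, par a u@_r.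

(* The quadratic map on odd elements with polarization cbr br that sends
   v (x) x^r to sq v (x) x^2r. The enumeration of the support only serves to
   list each unordered pair of exponents once. *)
Definition csq br (sq : l -> l) u : current S l :=
  let s := enum_fset (msupp u) in
  \sum_(r <- s) << sq u@_r *g r + r >>
  + \sum_(j < size s) \sum_(i < j) << br u@_(s`_i) u@_(s`_j) *g s`_i + s`_j >>.

Lemma cbrU br x y r s : left_zero 0 br -> right_zero 0 br ->
  cbr br << x *g r >> << y *g s >> = << br x y *g r + s >>.
Proof.
move=> br0l br0r; rewrite /cbr !msuppU.
have [->|_] := eqVneq x 0; first by rewrite big_seq_fset0 br0l monalgU0.
rewrite big_seq_fset1 mcoeffUU.
have [->|_] := eqVneq y 0; first by rewrite big_seq_fset0 br0r monalgU0.
by rewrite big_seq_fset1 mcoeffUU.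
Qed.

Lemma csqU br sq x r : sq 0 = 0 ->
  csq br sq << x *g r >> = << sq x *g r + r >>.
Proof.
move=> sq0; rewrite /csq /=.
have sz : (size (enum_fset (msupp << x *g r >>)) <= 1)%N.
  by rewrite msuppU; case: eqP => _; rewrite ?cardfs0 ?cardfs1.
rewrite [X in _ + X]big1 ?addr0 => [|[j hj] _]; last first.
  rewrite big1 // => -[i hi] _.
  by move: (leq_trans hj sz) hi; rewrite ltnS leqn0 => /eqP /= ->.
rewrite msuppU; have [->|_] := eqVneq x 0.
  by rewrite big_seq_fset0 sq0 monalgU0.
by rewrite big_seq_fset1 mcoeffUU.
Qed.

End CurrentOperations.

Variant expo_kind := Current | Loop.

Definition expo (k : expo_kind) : nmodType :=
  match k with Current => (nat : nmodType) | Loop => (int : nmodType) end.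

Section LieAlgebras.
Context (K : fieldType) (l : lmodType K).
Implicit Types (br : l -> l -> l) (par : bool -> l -> Prop).

Record lie_algebra br : Prop := LieAlgebra {
  lie_linear_l : forall a x y z, br (a *: x + y) z = a *: br x z + br y z;
  lie_linear_r : forall a x y z, br x (a *: y + z) = a *: br x y + br x z;
  lie_alt : forall x, br x x = 0;
  lie_jacobi : forall x y z, br x (br y z) = br (br x y) z + br y (br x z) }.

(* par false and par true are the even and the odd part *)
Record grading par : Prop := Grading {
  gr_zero : forall a, par a 0;
  gr_linear : forall a (c : K) x y, par a x -> par a y -> par a (c *: x + y);
  gr_sum : forall x, exists x0 x1,
    [/\ par false x0, par true x1 & x = x0 + x1];
  gr_direct : forall x, par false x -> par true x -> x = 0 }.

(* A definition that is valid in every characteristic. Away from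
   characteristic 2 the squaring is no extra structure: it has to be
   sq y = [y, y] / 2 (see lie_super_sqE and lie_super_of_bracket). In
   characteristic 2 it is the usual additional datum, and the square of an odd
   element of the enveloping algebra is not controlled by the bracket alone.
   The axioms lie_super_alt and lie_super_odd follow from the other ones in
   characteristics other than 2 and 3, respectively. *)
Record lie_superalgebra par br (sq : l -> l) : Prop := LieSuperalgebra {
  lie_super_grading : grading par;
  lie_super_linear_l : forall a x y z,
    br (a *: x + y) z = a *: br x z + br y z;
  lie_super_linear_r : forall a x y z,
    br x (a *: y + z) = a *: br x y + br x z;
  lie_super_par : forall a b x y,
    par a x -> par b y -> par (a (+) b) (br x y);
  lie_super_anti : forall a b x y, par a x -> par b y ->
    br x y = - ((-1) ^+ (a && b) *: br y x);
  lie_super_jacobi : forall a b x y z, par a x -> par b y ->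
    br x (br y z) = br (br x y) z + (-1) ^+ (a && b) *: br y (br x z);
  lie_super_alt : forall x, par false x -> br x x = 0;
  lie_super_odd : forall y, par true y -> br y (br y y) = 0;
  sq_par : forall y, par true y -> par false (sq y);
  sq_scale : forall a y, par true y -> sq (a *: y) = a ^+ 2 *: sq y;
  sq_add : forall x y, par true x -> par true y ->
    sq (x + y) = sq x + sq y + br x y;
  sq_ad : forall y z, par true y -> br (sq y) z = br y (br y z) }.

Lemma lie_super_sqE par br sq : lie_superalgebra par br sq ->
  2%:R != 0 :> K -> forall y, par true y -> sq y = 2%:R^-1 *: br y y.
Proof.
move=> h n2 y py; have := sq_scale h 2%:R py.
rewrite scaler_nat mulr2n (sq_add h py py) => e.
have {e} -> : br y y = 2%:R *: sq y.
  apply: (addrI (sq y + sq y)); rewrite e -mulr2n -scaler_nat -scalerDl.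
  by congr (_ *: _); ring.
by rewrite scalerA mulVf // scale1r.
Qed.

Lemma lie_super_of_bracket par br : 2%:R != 0 :> K ->
  grading par ->
  (forall a x y z, br (a *: x + y) z = a *: br x z + br y z) ->
  (forall a x y z, br x (a *: y + z) = a *: br x y + br x z) ->
  (forall a b x y, par a x -> par b y -> par (a (+) b) (br x y)) ->
  (forall a b x y, par a x -> par b y ->
    br x y = - ((-1) ^+ (a && b) *: br y x)) ->
  (forall a b x y z, par a x -> par b y ->
    br x (br y z) = br (br x y) z + (-1) ^+ (a && b) *: br y (br x z)) ->
  (forall y, par true y -> br y (br y y) = 0) ->
  lie_superalgebra par br (fun y => 2%:R^-1 *: br y y).
Proof.
move=> n2 hgr linl linr hpar anti jac odd3.
have half (v : l) : v + v = 2%:R *: v by rewrite scaler_nat mulr2n.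
have br0l z : br 0 z = 0.
  apply: (addrI (br 0 z)); have := linl 1 0 0 z.
  by rewrite !scale1r !addr0 => <-.
have br0r z : br z 0 = 0.
  apply: (addrI (br z 0)); have := linr 1 z 0 0.
  by rewrite !scale1r !addr0 => <-.
have brZl a x z : br (a *: x) z = a *: br x z.
  by rewrite -[a *: x]addr0 linl br0l addr0.
have brZr a x z : br x (a *: z) = a *: br x z.
  by rewrite -[a *: z]addr0 linr br0r addr0.
have brDl x y z : br (x + y) z = br x z + br y z.
  by rewrite -[x in x + y]scale1r linl scale1r.
have brDr x y z : br z (x + y) = br z x + br z y.
  by rewrite -[x in x + y]scale1r linr scale1r.
have half0 (v : l) : v + v = 0 -> v = 0.
  by rewrite half => /eqP; rewrite scaler_eq0 (negPf n2) => /eqP ->.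
split=> //.
- move=> x px; apply: half0; rewrite {1}(anti _ _ _ _ px px) /= expr0 scale1r.
  by rewrite addNr.
- move=> y py; rewrite -[_ *: _]addr0; apply: (gr_linear hgr).
    exact: (hpar _ _ _ _ py py).
  exact: (gr_zero hgr).
- by move=> a y py; rewrite brZl brZr !scalerA; congr (_ *: _); ring.
- move=> x y px py.
  have e : br y x = br x y.
    by rewrite (anti _ _ _ _ py px) /= expr1 scaleN1r opprK.
  rewrite brDl !brDr e -addrA (addrA (br x y)) (addrC _ (br y y)) half addrA.
  by rewrite !scalerDr scalerA mulVf // scale1r.
- move=> y z py; rewrite brZl.
  have := jac _ _ y y z py py.
  rewrite /= expr1 scaleN1r => e.
  have -> : br (br y y) z = br y (br y z) + br y (br y z).
    by apply: (addIr (- br y (br y z))); rewrite addrK -e.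
  by rewrite half scalerA mulVf // scale1r.
Qed.

Definition lie_center br (z : l) : Prop := forall y, br z y = 0.

(* s_i(x, y), where i s_i(x, y) is the coefficient of t^(i-1) in
   ad(t x + y)^(p-1)(x), computed in l (x) K[t] *)
Definition jacobson br (p : nat) (x y : l) (i : nat) : l :=
  i%:R^-1 *:
    (iter p.-1 (cbr br (<< x *g 1%N >> + << y *g 0%N >> : current nat l))
       (<< x *g 0%N >> : current nat l))@_(i.-1).

(* pm is a p-map on the subalgebra D (all of l for Lie algebras, the even part
   for Lie superalgebras), whose elements act on all of l; outside of D the
   function pm carries no information. *)
Record restricted br (p : nat) (D : l -> Prop) (pm : l -> l) : Prop :=
  Restricted {
  pmap_stable : forall x, D x -> D (pm x);
  pmap_ad : forall x y, D x -> iter p (br x) y = br (pm x) y;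
  pmap_scale : forall a x, D x -> pm (a *: x) = a ^+ p *: pm x;
  pmap_add : forall x y, D x -> D y ->
    pm (x + y) = pm x + pm y + \sum_(1 <= i < p) jacobson br p x y i }.

Definition basis_on (I : choiceType) (e : I -> l) (A : {pred I})
    (V : l -> Prop) : Prop :=
  [/\ forall i, i \in A -> V (e i),
      forall s : seq I, uniq s -> {subset s <= A} -> forall c : I -> K,
        \sum_(i <- s) c i *: e i = 0 -> forall i, i \in s -> c i = 0
    & forall v, V v -> exists (s : seq I) (c : I -> K),
        {subset s <= A} /\ v = \sum_(i <- s) c i *: e i].

End LieAlgebras.

Section EnvelopingAlgebras.
Context (K : fieldType) (g : lmodType K).
Implicit Types (br : g -> g -> g) (par : bool -> g -> Prop).

Definition lie_rep br (A : algType K) (f : g -> A) : Prop :=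
  linear f /\ forall x y, f (br x y) = f x * f y - f y * f x.

Definition lie_super_rep par br (sq : g -> g) (A : algType K) (f : g -> A) :
    Prop :=
  [/\ linear f,
      forall a b x y, par a x -> par b y ->
        f (br x y) = f x * f y - (-1) ^+ (a && b) * (f y * f x)
    & forall y, par true y -> f (sq y) = f y ^+ 2].

(* (U, iota) is universal among the maps satisfying rep into associative unital
   algebras *)
Definition universal (rep : forall A : algType K, (g -> A) -> Prop)
    (U : algType K) (iota : g -> U) : Prop :=
  rep U iota /\
  forall (A : algType K) (f : g -> A), rep A f ->
    exists phi : {lrmorphism U -> A},
      (forall x, phi (iota x) = f x) /\
      forall psi : {lrmorphism U -> A},
        (forall x, psi (iota x) = f x) -> psi =1 phi.

Definition enveloping_algebra br (U : algType K) (iota : g -> U) : Prop :=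
  universal (@lie_rep br) iota.

Definition enveloping_superalgebra par br sq (U : algType K) (iota : g -> U) :
    Prop :=
  universal (@lie_super_rep par br sq) iota.

Section InEnvelope.
Context (U : algType K) (iota : g -> U).

Definition center (z : U) : Prop := forall u, z * u - u * z = 0.

Inductive env_par par : bool -> U -> Prop :=
| EnvParGen a x : par a x -> env_par par a (iota x)
| EnvParZero a : env_par par a 0
| EnvParOne : env_par par false 1
| EnvParLinear a (c : K) u v :
    env_par par a u -> env_par par a v -> env_par par a (c *: u + v)
| EnvParMul a b u v :
    env_par par a u -> env_par par b v -> env_par par (a (+) b) (u * v).

Definition scomm (a b : bool) (z u : U) : U :=
  z * u - (-1) ^+ (a && b) * (u * z).

(* The four terms are the superbracket of z = z0 + z1 and u = u0 + u1. *)
Definition super_center par (z : U) : Prop :=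
  exists z0 z1, [/\ env_par par false z0, env_par par true z1, z = z0 + z1
    & forall u0 u1, env_par par false u0 -> env_par par true u1 ->
        scomm false false z0 u0 + scomm false true z0 u1
        + scomm true false z1 u0 + scomm true true z1 u1 = 0].

End InEnvelope.

End EnvelopingAlgebras.

Section Subalgebras.
Import mpoly.
Context (K : fieldType) (U : algType K).

Inductive subalg (G : U -> Prop) : U -> Prop :=
| SubalgGen u : G u -> subalg G u
| SubalgOne : subalg G 1
| SubalgLinear (c : K) u v : subalg G u -> subalg G v -> subalg G (c *: u + v)
| SubalgMul u v : subalg G u -> subalg G v -> subalg G (u * v).

Definition alg_independent (T : choiceType) (A : {pred T}) (x : T -> U) :
    Prop :=
  forall (n : nat) (t : 'I_n -> T), injective t -> (forall k, t k \in A) ->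
  forall P : mpoly n K,
    mmap (in_alg U) (fun k => x (t k)) P = 0 -> P = 0.

(* Algebraic independence of the indexed family includes that its members are
   pairwise distinct. *)
Definition freely_generated (Z : U -> Prop) (T : choiceType) (A : {pred T})
    (x : T -> U) : Prop :=
  [/\ forall t t', t \in A -> t' \in A -> x t * x t' = x t' * x t,
      forall z, Z z <-> subalg (fun u => exists2 t, t \in A & u = x t) z
    & alg_independent A x].

Definition p_center (p : nat) (g : lmodType K) (D : g -> Prop) (pm : g -> g)
    (iota : g -> U) : U -> Prop :=
  subalg (fun u => exists2 y, D y & u = iota y ^+ p - iota (pm y)).

End Subalgebras.

(* Main.v *)
(* The idea is to compare the enveloping algebra with its associated graded
   algebra. By the Poincare-Birkhoff-Witt theorem, proved by rewriting words
   in a totally ordered basis e_i (x) x^r (r is compared first) to normal words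
   and checking that overlapping rewriting steps agree, the normal words form a
   basis of U(g). Let z be a homogeneous supercentral element of degree d and let
   y = e_b (x) x^s with s so large that all letters of [e_i (x) x^r, y] exceed the
   letters of z. In degree d, the coefficient of a normal word m e_{k,r+s} in
   [z, y] only involves the words of z that arise from m by inserting some e_{ir}
   (with this r), so its vanishing for all b and k says that a combination of the
   e_i commutes with l. Hence in every word of z of degree d a letter e_{ir} with
   i outside J is even and has multiplicity divisible by p. Such words are the
   leading words of monomials in the asserted generators, and distinct monomials
   have distinct leading words: this gives generation, by induction on d, and
   algebraic independence. The Lie algebra case is the superalgebra case with zero
   odd part. *)

From HB Require Import structures.
Require Import Defs.
From mathcomp Require Import all_boot all_order all_algebra finmap ring zify.
From mathcomp.multinomials Require Import monalg.
From mathcomp.multinomials Require mpoly.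
From mathcomp Require boolp wochoice.

Set Implicit Arguments.
Unset Strict Implicit.
Unset Printing Implicit Defensive.

Import GRing.Theory.
Local Open Scope ring_scope.

(** * Linear extension from a basis *)

(** The envelope is known only through its universal property, so independence of the normal words
    is obtained by turning their formal span into an algebra and mapping [U] to it. The obstacle for
    the center is that the terms of [z, y] could interfere and need further rewriting. A far
    exponent s prevents this: a new letter can be moved to the end of its word, where it is
    recognised, and its exponent r + s reveals the exponent r of the letter it replaced. What
    remains is a formal derivative. An even letter contributes its number of occurrences, which
    vanishes in K exactly for multiples of p; an odd letter occurs at most once and contributes a
    sign, which never vanishes. This also settles parity: as [J] is even, the words of top degree
    have only even letters, so an odd supercentral element is 0 and the supercenter consists of the
    even elements that are central in the ordinary sense. Squares of odd elements are kept as a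
    separate datum throughout, so that characteristic 2 needs no separate argument. *)

Section LinearExtension.
Context (K : fieldType) (T : choiceType).

Definition lin (W : lmodType K) (F : T -> W) (g : {malg K[T]}) : W :=
  \sum_(k <- msupp g) g@_k *: F k.

Lemma linEw (W : lmodType K) (F : T -> W) (g : {malg K[T]}) (d : {fset T}) :
  {subset msupp g <= d} -> lin F g = \sum_(k <- d) g@_k *: F k.
Proof.
move=> sgd; rewrite /lin; apply: big_fset_incl; first exact/fsubsetP.
by move=> x _ /mcoeff_outdom ->; rewrite scale0r.
Qed.

Lemma lin_is_linear (W : lmodType K) (F : T -> W) : linear (lin F).
Proof.
move=> a g h; pose d := (msupp g `|` msupp h `|` msupp (a *: g + h))%fset.
have sub (x y z : {fset T}) : d = (x `|` y `|` z)%fset ->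
    [/\ {subset x <= d}, {subset y <= d} & {subset z <= d}].
  by move=> ->; split=> t ht; rewrite !inE ht ?orbT.
have [s1 s2 s3] := sub _ _ _ erefl.
rewrite (linEw F s1) (linEw F s2) (linEw F s3) scaler_sumr -big_split /=.
apply: eq_bigr => k _; rewrite mcoeffD mcoeffZ scalerDl scalerA //.
Qed.

HB.instance Definition _ (W : lmodType K) (F : T -> W) :=
  GRing.isLinear.Build K {malg K[T]} W _ (lin F) (lin_is_linear F).

Lemma linU (W : lmodType K) (F : T -> W) c k : lin F << c *g k >> = c *: F k.
Proof.
rewrite (@linEw _ _ _ [fset k]%fset) ?big_seq_fset1 ?mcoeffUU //.
exact/fsubsetP/msuppU_le.
Qed.

Lemma linX (W : lmodType K) (F : T -> W) k : lin F << k >> = F k.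
Proof. by rewrite linU scale1r. Qed.

Lemma eq_lin (W : lmodType K) (F G : T -> W) (g : {malg K[T]}) :
  (forall k, g@_k != 0 -> F k = G k) -> lin F g = lin G g.
Proof.
by move=> eqFG; apply: eq_big_seq => k kg; rewrite eqFG // mcoeff_neq0.
Qed.

Lemma lin_comp (W W' : lmodType K) (f : {linear W -> W'}) (F : T -> W) g :
  f (lin F g) = lin (f \o F) g.
Proof. by rewrite /lin linear_sum; apply: eq_bigr => k _; rewrite linearZ. Qed.

Lemma linD (W : lmodType K) (F G : T -> W) g :
  lin (fun k => F k + G k) g = lin F g + lin G g.
Proof.
by rewrite /lin -big_split; apply: eq_bigr => k _; rewrite scalerDr.
Qed.

Lemma linZ (W : lmodType K) a (F : T -> W) g :
  lin (fun k => a *: F k) g = a *: lin F g.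
Proof.
by rewrite /lin scaler_sumr; apply: eq_bigr => k _; rewrite !scalerA mulrC.
Qed.

Lemma linB (W : lmodType K) (F G : T -> W) g :
  lin (fun k => F k - G k) g = lin F g - lin G g.
Proof.
rewrite -[X in _ - X]scale1r -scaleNr -linZ -linD; apply: eq_lin => k _.
by rewrite scaleN1r.
Qed.

Lemma lin_id (g : {malg K[T]}) : lin (fun k => << k >>) g = g.
Proof.
rewrite [RHS]monalgE /lin; apply: eq_bigr => k _; apply/malgP => j.
by rewrite mcoeffZ !mcoeffU mulrnAr mulr1.
Qed.

Lemma lin0 (W : lmodType K) (g : {malg K[T]}) : lin (fun _ => 0 : W) g = 0.
Proof. by rewrite /lin big1 // => k _; rewrite scaler0. Qed.

End LinearExtension.

Lemma lin_exchange (K : fieldType) (T T' : choiceType) (W : lmodType K)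
    (F : T -> T' -> W) g h :
  lin (fun a => lin (F a) h) g = lin (fun b => lin (F^~ b) g) h.
Proof.
rewrite /lin; under eq_bigr do rewrite scaler_sumr.
under [in RHS]eq_bigr do rewrite scaler_sumr.
rewrite exchange_big /=; apply: eq_bigr => k _; apply: eq_bigr => j _.
by rewrite !scalerA mulrC.
Qed.

(** Brackets and the map into the envelope are linear only by hypothesis, so the bundled linear map
    is packed here on the fly. *)
Lemma linear_lin (K : fieldType) (T : choiceType) (W W' : lmodType K)
    (f : W -> W') (F : T -> W) (g : {malg K[T]}) :
  linear f -> f (lin F g) = lin (f \o F) g.
Proof.
move=> lf; pose m := GRing.isLinear.Build K W W' _ f lf.
pose f' : {linear W -> W'} := HB.pack f m.
exact: (lin_comp f').
Qed.

(** * Rewriting words to normal form *)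

Section NormalWords.
Context (X : choiceType) (leX : rel X) (pX : pred X).
Context (leX_refl : reflexive leX).
Context (leX_anti : antisymmetric leX).
Context (leX_trans : transitive leX).
Context (leX_total : total leX).
Implicit Types (a b c : X) (u v w : seq X).

(** An even letter may stand next to itself, an odd one may not: [normal] words are the PBW
    monomials, nondecreasing with odd letters used at most once. *)
Definition good a b := leX a b && ((a != b) || ~~ pX a).
Definition normal w := sorted good w.
Definition normal_word : predArgType := {w : seq X | normal w}.

(** By transitivity subsequences of normal words are normal; this detects redexes and later permits
    deleting a letter. *)
Lemma good_trans : transitive good.
Proof.
move=> b a c /andP[lab hab] /andP[lbc hbc]; rewrite /good (leX_trans lab lbc).
case: (eqVneq a c) => //= eac; subst c.
have eab : a = b by apply: leX_anti; rewrite lab lbc.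
by subst b; rewrite eqxx in hab.
Qed.

Lemma badP a b : ~~ good a b ->
  (a = b /\ pX a) \/ (a != b /\ ~~ leX a b).
Proof.
rewrite /good negb_and negb_or !negbK => /orP[nle|/andP[/eqP -> ->]]; last by left.
by right; split=> //; apply: contraNneq nle => ->; rewrite leX_refl.
Qed.

(** Always the leftmost bad pair, so that reduction is a function; [normal_form_bad] removes the
    dependence on this choice. *)
Fixpoint redex w : option (seq X * X * X * seq X) :=
  if w is a :: w' then
    if w' is b :: v then
      if good a b then
        if redex w' is Some (u, c, d, v') then Some (a :: u, c, d, v')
        else None
      else Some ([::], a, b, v)
    else None
  else None.

Lemma redex_cons a b v : redex [:: a, b & v] =
  if good a b then
    if redex (b :: v) is Some (u, c, d, v') then Some (a :: u, c, d, v')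
    else None
  else Some ([::], a, b, v).
Proof. by []. Qed.

Lemma redexP w : if redex w is Some (u, a, b, v) then
  w = u ++ a :: b :: v /\ ~~ good a b else normal w.
Proof.
elim: w => [|a [|b v] IH] //; rewrite redex_cons.
case: ifPn => // gab; case: redex IH => [[[[u c] d] v'] [-> ?]|] //.
by rewrite /normal /= gab.
Qed.

Lemma redex_normal w : normal w -> redex w = None.
Proof.
rewrite /normal; elim: w => [|a [|b v] IH] //; rewrite redex_cons => /andP[-> h].
by rewrite IH.
Qed.

Lemma redex_bad u a b v : ~~ good a b ->
  exists u' a' b' v', redex (u ++ a :: b :: v) = Some (u', a', b', v').
Proof.
move=> nab; case: (redex _) (redexP (u ++ a :: b :: v)) => [[[[u' a'] b'] v']|].
  by move=> _; exists u', a', b', v'.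
rewrite /normal => /(subseq_sorted good_trans) h.
have : subseq [:: a; b] (u ++ a :: b :: v).
  by rewrite (subseq_trans _ (suffix_subseq u _)) //= !eqxx sub0seq.
by move=> /h /=; rewrite (negPf nab).
Qed.

Fixpoint inversions w : nat :=
  if w is a :: w' then (count (fun x => ~~ leX a x) w' + inversions w')%N else 0.

Lemma inversions_le w : (inversions w <= size w * size w)%N.
Proof.
elim: w => //= a w IH; have := count_size (fun x => ~~ leX a x) w.
move: IH; set n := size w; nia.
Qed.

Lemma inversions_swap u a b v : ~~ leX a b ->
  (inversions (u ++ b :: a :: v) < inversions (u ++ a :: b :: v))%N.
Proof.
move=> nab; have lba : leX b a by have := leX_total a b; rewrite (negPf nab).
elim: u => [|x u IH] /=; first by rewrite nab lba; lia.
by rewrite !count_cat /=; lia.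
Qed.

(* The rewriting rules turn a word into words of the same length with fewer
   inversions and into shorter words with possibly more inversions. *)
Definition mu w := (size w ^ 3 + inversions w)%N.
Arguments mu : simpl never.

Lemma expn3S n : (n.+1 ^ 3 = n ^ 3 + 3 * (n * n) + 3 * n + 1)%N.
Proof. by rewrite !expnS !expn0 !muln1; lia. Qed.

(** A word of length n has at most n^2 inversions, fewer than (n + 1)^3 - n^3; hence the cube in
    [mu]. *)
Lemma mu_size w w' : (size w' < size w)%N -> (mu w' < mu w)%N.
Proof.
move=> lt; have le_inv := inversions_le w'; rewrite /mu.
have : ((size w').+1 ^ 3 <= size w ^ 3)%N by rewrite leq_exp2r.
rewrite expn3S; move: (size w ^ 3)%N (size w' ^ 3)%N le_inv => x y.
lia.
Qed.

Lemma mu_swap u a b v : ~~ leX a b ->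
  (mu (u ++ b :: a :: v) < mu (u ++ a :: b :: v))%N.
Proof. by move=> /inversions_swap -/(_ u v); rewrite /mu !size_cat /=; lia. Qed.

Lemma normal_uniq_perm w w' : normal w -> normal w' -> perm_eq w w' -> w = w'.
Proof.
move=> nw nw'; apply: (sorted_eq leX_trans leX_anti).
  by apply: sub_sorted nw => x y /andP[].
by apply: sub_sorted nw' => x y /andP[].
Qed.

End NormalWords.

(** * Signs and ordered bases of Lie superalgebras *)

Definition koszul (K : fieldType) (a b : bool) : K := (-1) ^+ (a && b).
Arguments koszul {K}.

Lemma koszulC {K : fieldType} a b : koszul a b = koszul b a :> K.
Proof. by rewrite /koszul andbC. Qed.

Lemma koszul_sq {K : fieldType} a b : koszul a b * koszul a b = 1 :> K.
Proof. by rewrite /koszul; case: (a && b); rewrite ?mulrNN ?mulr1. Qed.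

Lemma koszulM_addb {K : fieldType} a b b' :
  koszul a b * koszul a b' = koszul a (b (+) b') :> K.
Proof.
rewrite /koszul; case: a b b' => [] [] [] /=;
  by rewrite ?expr0 ?expr1 ?mulrNN ?mulr1 ?mul1r.
Qed.

Definition homog (K : fieldType) (g : lmodType K) (X : choiceType) (pX : pred X)
    (co : g -> {malg K[X]}) (q : bool) (u : g) :=
  forall c, (co u)@_c != 0 -> pX c = q.

(* A Lie superalgebra given by a totally ordered homogeneous basis [e] with
   coordinate map [co]; [Q x] is the square of the odd basis element [e x]. *)
Record super_basis (K : fieldType) (g : lmodType K) (X : choiceType)
    (leX : rel X) (pX : pred X) (e : X -> g) (co : {linear g -> {malg K[X]}})
    (br : g -> g -> g) (Q : X -> g) : Prop := SuperBasis {
  sb_refl : reflexive leX;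
  sb_anti : antisymmetric leX;
  sb_trans : transitive leX;
  sb_total : total leX;
  sb_coe : forall x, co (e x) = << x >>;
  sb_lin : forall u, lin e (co u) = u;
  sb_br_l : forall y, linear (br^~ y);
  sb_br_r : forall x, linear (br x);
  sb_par : forall a b, homog pX co (pX a (+) pX b) (br (e a) (e b));
  sb_br_anti : forall a b,
    br (e a) (e b) = - (koszul (pX a) (pX b) *: br (e b) (e a));
  sb_alt : forall a, ~~ pX a -> br (e a) (e a) = 0;
  sb_jacobi : forall a b c, br (e a) (br (e b) (e c)) =
    br (br (e a) (e b)) (e c) + koszul (pX a) (pX b) *: br (e b) (br (e a) (e c));
  sb_odd : forall a, pX a -> br (e a) (br (e a) (e a)) = 0;
  sb_Q_par : forall a, pX a -> homog pX co false (Q a);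
  sb_Q_double : forall a, pX a -> br (e a) (e a) = Q a + Q a;
  sb_Q_ad : forall a b, pX a -> br (Q a) (e b) = br (e a) (br (e a) (e b)) }.

Section NormalForms.
Context (K : fieldType) (g : lmodType K) (X : choiceType).
Context (leX : rel X) (pX : pred X) (e : X -> g) (co : {linear g -> {malg K[X]}}).
Context (br : g -> g -> g) (Q : X -> g) (SB : super_basis leX pX e co br Q).
Let leX_refl := sb_refl SB.
Let leX_anti := sb_anti SB.
Let leX_trans := sb_trans SB.
Let leX_total := sb_total SB.
Let lin_co := sb_lin SB.
Let br_l := sb_br_l SB.
Let br_r := sb_br_r SB.
Let br_par := sb_par SB.
Let br_anti := sb_br_anti SB.
Let br_alt := sb_alt SB.
Let br_jacobi := sb_jacobi SB.
Let br_odd := sb_odd SB.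
Let Q_par := sb_Q_par SB.
Let Q_double := sb_Q_double SB.
Let Q_ad := sb_Q_ad SB.
Local Notation homog := (homog pX co).

Local Notation good := (good leX pX).
Local Notation normal := (normal leX pX).
Local Notation N := (normal_word leX pX).
Local Notation redex := (redex leX pX).
Local Notation mu := (mu leX).

(* [V] is abstract, with separating coordinates [vcoef], so that identities in
   [V] reduce to identities in [K], which [ring] proves. *)
Context (V : lmodType K) (emb : N -> V) (vcoef : N -> V -> K).
Context (vcoefD : forall n x y, vcoef n (x + y) = vcoef n x + vcoef n y).
Context (vcoefZ : forall n a x, vcoef n (a *: x) = a * vcoef n x).
Context (vcoef_inj : forall x y, (forall n, vcoef n x = vcoef n y) -> x = y).

Definition letters (u : g) : {malg K[seq X]} := lin (fun c => << [:: c] >>) (co u).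

(** For a bad pair the case a = b arises only for odd a, where the rule is a a = Q(a). Dividing
    [a, a] by 2 is avoided, so characteristic 2 is included. *)
Definition red a b : {malg K[seq X]} :=
  if a == b then letters (Q a)
  else koszul (pX a) (pX b) *: << [:: b; a] >> + letters (br (e a) (e b)).

Lemma lin_letters (F : seq X -> V) u : lin F (letters u) = lin (fun c => F [:: c]) (co u).
Proof. by rewrite lin_comp; apply: eq_lin => c _ /=; rewrite linX. Qed.

Lemma lin_red (F : seq X -> V) a b : lin F (red a b) =
  if a == b then lin (fun c => F [:: c]) (co (Q a))
  else koszul (pX a) (pX b) *: F [:: b;
    a] + lin (fun c => F [:: c]) (co (br (e a) (e b))).
Proof.
rewrite /red; case: ifP => _; first by rewrite lin_letters.
by rewrite linearD linearZ /= linX lin_letters.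
Qed.

(** Carries induction hypotheses through [lin]: in context, the words that a bad pair produces all
    have smaller [mu]. *)
Lemma eq_lin_red (F G : seq X -> V) a b : ~~ good a b ->
  (~~ leX a b -> F [:: b; a] = G [:: b; a]) ->
  (forall c, F [:: c] = G [:: c]) -> lin F (red a b) = lin G (red a b).
Proof.
move=> /(badP leX_refl) bad h1 h2; rewrite !lin_red.
have h (u : g) : lin (fun c => F [:: c]) (co u) = lin (fun c => G [:: c]) (co u).
  by apply: eq_lin => c _; rewrite h2.
case: bad => [[-> _]|[/negPf -> /h1 ->]]; first by rewrite eqxx h.
by rewrite h.
Qed.

Definition nword (w : seq X) : N := insubd (exist normal [::] isT) w.

(** The default 0 is never met when the fuel exceeds [mu w]; by [normal_form_fuel_eq] the amount is
    then irrelevant. *)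
Fixpoint normal_form_fuel n (w : seq X) : V :=
  if n is n'.+1 then
    if redex w is Some (u, a, b, v) then
      lin (fun r => normal_form_fuel n' (u ++ r ++ v)) (red a b)
    else emb (nword w)
  else 0.

Lemma mu_step (P : seq X -> Prop) u a b v : ~~ good a b ->
  (forall w, (mu w < mu (u ++ a :: b :: v))%N -> P w) ->
  (~~ leX a b -> P (u ++ b :: a :: v)) /\ (forall c, P (u ++ c :: v)).
Proof.
move=> nab h; split=> [lab|c]; apply: h.
  exact: mu_swap.
by apply: mu_size; rewrite !size_cat /=; lia.
Qed.

Lemma normal_form_fuelS n w : normal_form_fuel n.+1 w =
  if redex w is Some (u, a, b, v) then
    lin (fun r => normal_form_fuel n (u ++ r ++ v)) (red a b)
  else emb (nword w).
Proof. by []. Qed.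

Lemma normal_form_fuel_eq n m w :
  (mu w < n)%N -> (mu w < m)%N -> normal_form_fuel n w = normal_form_fuel m w.
Proof.
elim: n m w => [//|n IH] [//|m] w hn hm; rewrite !normal_form_fuelS.
case: redex (redexP leX pX w) => [[[[u a] b] v]|//].
move=> -[ew nab]; rewrite ew in hn hm.
have hw w' : (mu w' < mu (u ++ a :: b :: v))%N ->
  normal_form_fuel n w' = normal_form_fuel m w'.
  by move=> h; apply: IH; apply: leq_trans h _.
have [h1 h2] := mu_step nab hw.
exact: eq_lin_red.
Qed.

Definition normal_form w := normal_form_fuel (mu w).+1 w.
Arguments normal_form : simpl never.

Lemma normal_form_normal w : normal w -> normal_form w = emb (nword w).
Proof. by rewrite /normal_form normal_form_fuelS => /redex_normal ->. Qed.

Lemma normal_form_redex w u a b v : redex w = Some (u, a, b, v) ->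
  normal_form w = lin (fun r => normal_form (u ++ r ++ v)) (red a b).
Proof.
move=> ew; rewrite {1}/normal_form normal_form_fuelS ew.
move: (redexP leX pX w); rewrite ew => -[ew' nab].
have hw w' : (mu w' < mu (u ++ a :: b :: v))%N ->
  normal_form_fuel (mu w) w' = normal_form w'.
  by rewrite -ew' => h; apply: normal_form_fuel_eq.
have [h1 h2] := mu_step nab hw.
exact: eq_lin_red.
Qed.

Definition normal_form_at u v (x : g) : V := lin (fun c =>
  normal_form (u ++ c :: v)) (co x).

Lemma normal_form_at_linear u v : linear (normal_form_at u v).
Proof. by move=> a x y; rewrite /normal_form_at linearP /= linearP. Qed.

Lemma normal_form_at0 u v : normal_form_at u v 0 = 0.
Proof. by rewrite /normal_form_at linear0 linear0. Qed.
Lemma normal_form_atN u v x : normal_form_at u v (- x) = - normal_form_at u v x.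
Proof. by rewrite /normal_form_at linearN linearN. Qed.
Lemma normal_form_atD u v x y : normal_form_at u v (x + y) =
  normal_form_at u v x + normal_form_at u v y.
Proof. by rewrite /normal_form_at linearD linearD. Qed.
Lemma normal_form_atZ u v a x : normal_form_at u v (a *: x) = a *: normal_form_at u v x.
Proof. by rewrite /normal_form_at linearZ linearZ. Qed.

Lemma normal_form_red_eq u v a b : a != b ->
  lin (fun r => normal_form (u ++ r ++ v)) (red a b) =
  koszul (pX a) (pX b) *: normal_form (u ++ b :: a :: v) +
    normal_form_at u v (br (e a) (e b)).
Proof. by move=> /negPf ab; rewrite lin_red ab. Qed.

Lemma normal_form_red_sq u v a :
  lin (fun r => normal_form (u ++ r ++ v)) (red a a) = normal_form_at u v (Q a).
Proof. by rewrite lin_red eqxx. Qed.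

(** The induction hypothesis of the diamond lemma. *)
Definition confluent_below n := forall u a b v,
  ~~ good a b -> (mu (u ++ a :: b :: v) < n)%N ->
  normal_form (u ++ a :: b :: v) = lin (fun r => normal_form (u ++ r ++ v)) (red a b).

(** Unlike a rewriting step this covers every pair: for a < b it is the step for b a solved for a b,
    as the sign squares to 1; for a = b odd it is [a, a] = 2 Q(a). *)
Lemma normal_form_comm n u v a b : confluent_below n ->
  (mu (u ++ a :: b :: v) < n)%N -> (mu (u ++ b :: a :: v) < n)%N ->
  normal_form (u ++ a :: b :: v) =
    koszul (pX a) (pX b) *: normal_form (u ++ b :: a :: v) +
    normal_form_at u v (br (e a) (e b)).
Proof.
move=> cf lab lba; case: (eqVneq a b) => [eab|nab].
  subst b; case: (boolP (pX a)) => pa.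
    have nga : ~~ good a a by rewrite /good eqxx pa andbF.
    rewrite cf // normal_form_red_sq Q_double // normal_form_atD /koszul /= expr1
      scaleN1r addKr //.
  by rewrite br_alt // normal_form_at0 addr0 /koszul /= expr0 scale1r.
case: (boolP (leX a b)) => [leab|nle];
  last by rewrite cf ?normal_form_red_eq // /good (negPf nle).
have nba : ~~ good b a.
  by apply/negP => /andP[leba _]; case/eqP: nab; apply: leX_anti; rewrite leab.
rewrite (cf _ _ _ _ nba lba) normal_form_red_eq 1?eq_sym // (br_anti a b)
  normal_form_atN normal_form_atZ scalerDr scalerA.
by rewrite (koszulC (pX b)) koszul_sq scale1r addrK.
Qed.

Lemma linearZ_of (W W' : lmodType K) (f : W -> W') : linear f -> scalable f.
Proof. exact: scalable_linear. Qed.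

Lemma linearN_of (W W' : lmodType K) (f : W -> W') : linear f -> {morph f : x / - x}.
Proof. by move=> lf x; rewrite -scaleN1r (linearZ_of lf) scaleN1r. Qed.

Lemma br_sumr x y : br x y = lin (fun c => br x (e c)) (co y).
Proof. by rewrite -[in LHS](lin_co y) (linear_lin e _ (br_r x)). Qed.
Lemma br_suml x y : br x y = lin (fun c => br (e c) y) (co x).
Proof. by rewrite -[in LHS](lin_co x) (linear_lin e _ (br_l y)). Qed.

Lemma normal_form_at_comm n u v x c q : confluent_below n -> homog q x ->
  (forall w, (size w <= (size u + size v).+2)%N -> (mu w < n)%N) ->
  normal_form_at u (c :: v) x = koszul q (pX c) *: normal_form_at (rcons u c) v x +
    normal_form_at u v (br x (e c)).
Proof.
move=> cf hx small; rewrite br_suml.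
rewrite (linear_lin _ _ (normal_form_at_linear u v)) /normal_form_at -linZ -linD;
  apply: eq_lin => d hd /=.
rewrite -(hx _ hd) cat_rcons; apply: (normal_form_comm cf); apply: small.
  by rewrite size_cat /=; lia.
by rewrite size_cat /=; lia.
Qed.

Lemma br_antix x c q : homog q x -> br x (e c) = - (koszul q (pX c) *: br (e c) x).
Proof.
move=> hx; rewrite br_suml br_sumr -linZ -scaleN1r -linZ; apply: eq_lin => d hd.
by rewrite -(hx _ hd) br_anti scaleN1r.
Qed.

Lemma normal_form_comm_rcons n u d v a b : confluent_below n ->
  (mu (u ++ d :: a :: b :: v) < n)%N -> (mu (u ++ d :: b :: a :: v) < n)%N ->
  normal_form (u ++ d :: a :: b :: v) =
    koszul (pX a) (pX b) *: normal_form (u ++ d :: b :: a :: v)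
    + normal_form_at (rcons u d) v (br (e a) (e b)).
Proof. by rewrite -!(cat_rcons d) => cf h1 h2; apply: normal_form_comm cf h1 h2. Qed.

Ltac module_coefficients :=
  repeat match goal with
  | |- context [normal_form_at ?u ?v ?x] => generalize (normal_form_at u v x); intro
  | |- context [normal_form ?w] => generalize (normal_form w); intro
  end;
  apply: vcoef_inj => ?; rewrite -?scaleN1r !(vcoefD, vcoefZ) /koszul.

(* The critical pairs: for a > b > c this is the Jacobi identity, and the cases of
   equal odd letters come down to [Q_ad] and [br_odd]. *)
Lemma red_overlap n u a b c v : confluent_below n ->
  (mu (u ++ a :: b :: c :: v) <= n)%N -> ~~ good a b -> ~~ good b c ->
  lin (fun r => normal_form (u ++ r ++ c :: v)) (red a b) =
  lin (fun r => normal_form (rcons u a ++ r ++ v)) (red b c).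
Proof.
move=> cf lew bab bbc.
have small w : (size w <= (size u + size v).+2)%N -> (mu w < n)%N.
  by move=> le_w; apply: leq_trans lew; apply: mu_size; rewrite size_cat /=; lia.
have mlt w : (mu w < mu (u ++ a :: b :: c :: v))%N -> (mu w < n)%N.
  by move=> h; apply: leq_trans lew.
have comm x d q hx := @normal_form_at_comm n u v x d q cf hx small.
have pab := @br_par a b; have pac := @br_par a c; have pbc := @br_par b c.
case: (badP leX_refl bab) (badP leX_refl bbc) =>
  [[eab pa]|[nab lab]] [[ebc pb]|[nbc lbc]].
(* The overlap a a a: the two results differ by [Q(a), a] = [a, [a, a]] = 0. *)
- subst b c; rewrite !normal_form_red_sq (comm _ _ _ (Q_par pa)) // Q_ad // br_odd //.
  by rewrite normal_form_at0 addr0 /koszul /= expr0 scale1r.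
(* The overlap a a c: [Q(a), c] = [a, [a, c]] matches the brackets produced by moving c past each a
   in turn. *)
- subst b; rewrite normal_form_red_sq normal_form_red_eq // cat_rcons.
  have m1 := mu_swap leX_total (rcons u a) v lbc; rewrite !cat_rcons in m1.
  have m2 := mu_swap leX_total u (a :: v) lbc.
  rewrite (normal_form_comm cf); [|exact: mlt|apply: mlt; exact: ltn_trans m2 m1].
  have bca : ~~ good a a by rewrite /good eqxx pa andbF.
  have := cf (rcons u c) a a v bca; rewrite !cat_rcons normal_form_red_sq => -> ;
    last first.
    by apply: mlt; exact: ltn_trans m2 m1.
  rewrite (comm _ _ _ (Q_par pa)) (comm _ _ _ pac) (Q_ad _ pa).
  rewrite (br_antix a pac) normal_form_atN normal_form_atZ pa.
  module_coefficients.
  by case: (pX c) => /=; rewrite ?expr0 ?expr1; ring.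
- subst c; rewrite normal_form_red_sq normal_form_red_eq //.
  have m1 := mu_swap leX_total u (b :: v) lab.
  have m2 := mu_swap leX_total (rcons u b) v lab; rewrite !cat_rcons in m2.
  rewrite (normal_form_comm_rcons cf); [|exact: mlt|apply: mlt; exact: ltn_trans m2 m1].
  rewrite cf; [|by [] |by apply: mlt; exact: ltn_trans m2 m1]; rewrite normal_form_red_sq.
  rewrite (comm _ _ _ (Q_par pb)) (comm _ _ _ pab) (Q_ad _ pb).
  rewrite (br_antix b pab) (br_anti a b) (linearN_of (br_r _)) (linearZ_of (br_r _))
    !(normal_form_atN, normal_form_atZ) pb.
  module_coefficients.
  by case: (pX a) => /=; rewrite ?expr0 ?expr1; ring.
- rewrite !normal_form_red_eq // cat_rcons.
  have nac : ~~ leX a c.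
    apply: contraNN lab => lac; have := leX_total b c; rewrite (negPf lbc) /=.
    exact: leX_trans lac.
  (* The two routes are abc, bac, bca, cba and abc, acb, cab, cba; each inequality bounds one word
     so that confluence applies to it. *)
  have m1 := mu_swap leX_total u (c :: v) lab.
  have m2 := mu_swap leX_total (rcons u b) v nac; rewrite !cat_rcons in m2.
  have m3 := mu_swap leX_total u (a :: v) lbc.
  have m4 := mu_swap leX_total (rcons u a) v lbc; rewrite !cat_rcons in m4.
  have m5 := mu_swap leX_total u (b :: v) nac.
  have l1 := mlt _ m1; have l2 := mlt _ (ltn_trans m2 m1).
  have l3 := mlt _ (ltn_trans m3 (ltn_trans m2 m1)).
  have l4 := mlt _ m4; have l5 := mlt _ (ltn_trans m5 m4).
  rewrite (normal_form_comm_rcons cf l1 l2) (normal_form_comm cf l2 l3)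
    (normal_form_comm cf l4 l5).
  rewrite (normal_form_comm_rcons cf l5 l3).
  rewrite (comm _ _ _ pab) (comm _ _ _ pac) (comm _ _ _ pbc).
  rewrite (br_antix a pbc) br_jacobi (br_antix b pac).
  rewrite !(normal_form_atN, normal_form_atD, normal_form_atZ).
  module_coefficients.
  by case: (pX a) (pX b) (pX c) => [] [] [] /=; rewrite ?expr0 ?expr1; ring.
Qed.

(** Disjoint reductions commute: on each side the other pair is reduced too, and [lin_exchange]
    swaps the double sum. *)
Lemma red_disjoint n u a b m c d v : confluent_below n ->
  (mu (u ++ a :: b :: m ++ c :: d :: v) <= n)%N -> ~~ good a b -> ~~ good c d ->
  lin (fun r => normal_form (u ++ r ++ m ++ c :: d :: v)) (red a b) =
  lin (fun r => normal_form ((u ++ a :: b :: m) ++ r ++ v)) (red c d).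
Proof.
move=> cf lew bab bcd.
pose G r r' := normal_form (u ++ r ++ m ++ r' ++ v).
have hl r : (mu (u ++ r ++ m ++ c :: d :: v) < n)%N ->
    normal_form (u ++ r ++ m ++ c :: d :: v) = lin (G r) (red c d).
  have := cf (u ++ r ++ m) c d v bcd; rewrite -!catA => h /h ->.
  by apply: eq_lin => r' _; rewrite /G -!catA.
have hr r : (mu ((u ++ a :: b :: m) ++ r ++ v) < n)%N ->
    normal_form ((u ++ a :: b :: m) ++ r ++ v) = lin (G^~ r) (red a b).
  rewrite -catA; exact: (cf u a b _ bab).
have sl w : (mu w < mu (u ++ a :: b :: m ++ c :: d :: v))%N -> (mu w < n)%N.
  by move=> h; apply: leq_trans lew.
have sr w : (mu w < mu ((u ++ a :: b :: m) ++ c :: d :: v))%N -> (mu w < n)%N.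
  by rewrite -catA; exact: sl.
have [l1 l2] := mu_step bab sl; have [r1 r2] := mu_step bcd sr.
have -> : lin (fun r => normal_form (u ++ r ++ m ++ c :: d :: v)) (red a b)
    = lin (fun r => lin (G r) (red c d)) (red a b).
  apply: (eq_lin_red bab) => [nle|x]; last exact: (hl [:: x] (l2 x)).
  by apply: (hl [:: b; a]); apply: l1.
have -> : lin (fun r => normal_form ((u ++ a :: b :: m) ++ r ++ v)) (red c d)
    = lin (fun r => lin (G^~ r) (red a b)) (red c d).
  apply: (eq_lin_red bcd) => [nle|x]; last exact: (hr [:: x] (r2 x)).
  by apply: (hr [:: d; c]); apply: r1.
exact: lin_exchange.
Qed.

Lemma cat_cons2_cases u1 a1 b1 v1 u2 a2 b2 v2 :
  u1 ++ a1 :: b1 :: v1 = u2 ++ a2 :: b2 :: v2 :> seq X ->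
  (size u1 <= size u2)%N ->
  [\/ [/\ u1 = u2, a1 = a2, b1 = b2 & v1 = v2],
      [/\ u2 = rcons u1 a1, b1 = a2 & v1 = b2 :: v2]
    | exists2 m, u2 = u1 ++ a1 :: b1 :: m & v1 = m ++ a2 :: b2 :: v2].
Proof.
elim: u1 u2 => [|x u1 IH] [|y u2] //=.
- by case=> -> -> -> _; apply: Or31.
- case=> <- {y}; case: u2 => [|z u2] /=; first by case=> -> -> _; apply: Or32.
  by case=> <- -> _; apply: Or33; exists u2.
case=> <- /IH h /h [[-> -> -> ->]|[-> -> ->]|[m -> ->]].
- exact: Or31.
- exact: Or32.
- by apply: Or33; exists m.
Qed.

Lemma reds_agree n u1 a1 b1 v1 u2 a2 b2 v2 : confluent_below n ->
  u1 ++ a1 :: b1 :: v1 = u2 ++ a2 :: b2 :: v2 ->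
  (mu (u1 ++ a1 :: b1 :: v1) <= n)%N -> ~~ good a1 b1 -> ~~ good a2 b2 ->
  lin (fun r => normal_form (u1 ++ r ++ v1)) (red a1 b1) =
  lin (fun r => normal_form (u2 ++ r ++ v2)) (red a2 b2).
Proof.
move=> cf; wlog le12 : u1 a1 b1 v1 u2 a2 b2 v2 / (size u1 <= size u2)%N.
  move=> h ew lew bad1 bad2; case: (leqP (size u1) (size u2)) => [le12|/ltnW le21].
    exact: h.
  by symmetry; apply: h; rewrite // -ew.
move=> ew lew bad1 bad2.
case: (cat_cons2_cases ew le12) => [[-> -> -> ->] //|[eu2 eb1 ev1]|[m eu2 ev1]].
  by subst u2 v1 b1; apply: (red_overlap cf lew bad1 bad2).
by subst u2 v1; apply: (red_disjoint cf lew bad1 bad2).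
Qed.

(** Bergman's diamond lemma, by induction on [mu]: the given pair and the leftmost one coincide,
    overlap or are disjoint, and [reds_agree] compares them using confluence for smaller words. *)
Lemma normal_form_bad u a b v : ~~ good a b ->
  normal_form (u ++ a :: b :: v) = lin (fun r => normal_form (u ++ r ++ v)) (red a b).
Proof.
have [n] := ubnP (mu (u ++ a :: b :: v)).
elim: n => // n IH in u a b v *; rewrite ltnS => lew bab.
have cf : confluent_below n by move=> *; apply: IH.
have [u' [a' [b' [v' ew]]]] := redex_bad leX_anti leX_trans u v bab.
rewrite (normal_form_redex ew); have := redexP leX pX (u ++ a :: b :: v);
  rewrite ew => -[ew' bab'].
by apply: (reds_agree (n := n)) => //; rewrite -ew'.
Qed.

Lemma normal_form_swap u v a b : normal_form (u ++ a :: b :: v) =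
  koszul (pX a) (pX b) *: normal_form (u ++ b :: a :: v) +
    normal_form_at u v (br (e a) (e b)).
Proof.
pose n := (mu (u ++ a :: b :: v) + mu (u ++ b :: a :: v)).+1.
apply: (@normal_form_comm n); [by move=> * ; apply: normal_form_bad | | ];
  rewrite /n ltnS.
  exact: leq_addr.
exact: leq_addl.
Qed.

Lemma normal_form_square u v a :
  pX a -> normal_form (u ++ a :: a :: v) = normal_form_at u v (Q a).
Proof. by move=> pa; rewrite normal_form_bad ?normal_form_red_sq // /good eqxx pa
  andbF. Qed.

(** Lets later facts be proved from the relations [nform_swap] and [nform_square], without [mu] or
    fuel. *)
Lemma word_ind (P : seq X -> Prop) :
  (forall w, normal w -> P w) ->
  (forall u a v, pX a -> (forall c, P (u ++ c :: v)) -> P (u ++ a :: a :: v)) ->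
  (forall u a b v, P (u ++ b :: a :: v) -> (forall c, P (u ++ c :: v)) ->
     P (u ++ a :: b :: v)) ->
  forall w, P w.
Proof.
move=> Pn Psq Psw w; have [n] := ubnP (mu w).
elim: n => // n IH in w *; rewrite ltnS => lew.
case: redex (redexP leX pX w) => [[[[u a] b] v]|]; last exact: Pn.
case=> ew bab; have [h1 h2] : (~~ leX a b ->
  P (u ++ b :: a :: v)) /\ (forall c, P (u ++ c :: v)).
  by apply: mu_step bab _ => w' lt; apply: IH; rewrite -ew in lt; apply: leq_trans lew.
rewrite ew; case: (badP leX_refl bab) => [[<- pa]|[_ nle]]; first exact: Psq.
by apply: Psw => //; apply: h1.
Qed.

End NormalForms.

(** * The Poincare-Birkhoff-Witt theorem *)

Section Words.
Context (K : fieldType) (g : lmodType K) (X : choiceType).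
Context (e : X -> g) (co : {linear g -> {malg K[X]}}).
Context (lin_co : forall u, lin e (co u) = u).
Context (U : algType K) (iota : g -> U) (iota_linear : linear iota).

Definition basis_word (w : seq X) : U := \prod_(x <- w) iota (e x).
Local Notation word := basis_word.

Lemma word_nil : word [::] = 1.
Proof. exact: big_nil. Qed.

Lemma word_cons x w : word (x :: w) = iota (e x) * word w.
Proof. exact: big_cons. Qed.

Lemma word1 x : word [:: x] = iota (e x).
Proof. exact: big_seq1. Qed.

Lemma word_cat u v : word (u ++ v) = word u * word v.
Proof. exact: big_cat. Qed.

Lemma iota_lin x : iota x = lin (fun y => iota (e y)) (co x).
Proof. by rewrite -[in LHS](lin_co x) (linear_lin _ _ iota_linear). Qed.

Lemma word_mid u v x :
  word u * iota x * word v = lin (fun y => word (u ++ y :: v)) (co x).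
Proof.
rewrite iota_lin /lin mulr_sumr mulr_suml; apply: eq_bigr => y _.
by rewrite -scalerAr -scalerAl word_cat word_cons mulrA.
Qed.

End Words.

Section PBWAlgebra.
Context (K : fieldType) (g : lmodType K) (X : choiceType).
Context (leX : rel X) (pX : pred X) (e : X -> g) (co : {linear g -> {malg K[X]}}).
Context (br : g -> g -> g) (Q : X -> g) (SB : super_basis leX pX e co br Q).

Local Notation normal := (normal leX pX).
Local Notation N := (normal_word leX pX).

(** A model in which the normal words are a basis by construction; independence in [U] is pulled
    back from it. *)
Definition pbw_algebra : Type := {malg K[N]}.
Local Notation A := pbw_algebra.
HB.instance Definition _ := GRing.Lmodule.on A.

(* locked, as conversion would otherwise run the rewriting procedure *)
Fact nform_key : unit. Proof. exact: tt. Qed.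
Definition nform : seq X -> A :=
  locked_with nform_key (normal_form e co br Q (fun n : N => << n >> : A)).
Lemma nformE : nform = normal_form e co br Q (fun n : N => << n >> : A).
Proof. exact: locked_withE. Qed.
Definition nel (u v : seq X) (x : g) : A := lin (fun c => nform (u ++ c :: v)) (co x).

Let coefD (n : N) (x y : A) : (x + y)@_n = x@_n + y@_n.
Proof. exact: mcoeffD. Qed.
Let coefZ (n : N) a (x : A) : (a *: x)@_n = a * x@_n.
Proof. exact: mcoeffZ. Qed.
Let coef_inj (x y : A) : (forall n : N, x@_n = y@_n) -> x = y.
Proof. by move/malgP. Qed.

Lemma nform_val (n : N) : nform (val n) = << n >>.
Proof. by rewrite nformE (normal_form_normal _ _ _ _ _ (valP n)) /nword valKd. Qed.

Lemma nform_normal w (nw : normal w) : nform w = << Sub w nw : N >>.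
Proof. by rewrite -[w in LHS](SubK N nw) nform_val. Qed.

Lemma nform_swap u v a b : nform (u ++ a :: b :: v) =
  koszul (pX a) (pX b) *: nform (u ++ b :: a :: v) + nel u v (br (e a) (e b)).
Proof. rewrite /nel nformE; exact: (normal_form_swap SB _ coefD coefZ coef_inj). Qed.

Lemma nform_square u v a : pX a -> nform (u ++ a :: a :: v) = nel u v (Q a).
Proof. rewrite /nel nformE; exact: (normal_form_square SB _ coefD coefZ coef_inj). Qed.

Lemma lin_nel (W : lmodType K) (f : N -> W) u v x :
  lin f (nel u v x) = lin (fun c => lin f (nform (u ++ c :: v))) (co x).
Proof. exact: (lin_comp (lin f)). Qed.

(** Every rewriting step inside w is also one inside u w v, so induction along the rewriting of w
    applies. Associativity of [amul] comes from this. *)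
Lemma nform_concat u v w :
  lin (fun n : N => nform (u ++ val n ++ v)) (nform w) = nform (u ++ w ++ v).
Proof.
elim/(word_ind SB): w => [w nw|u' a v' pa IH|u' a b v' IH1 IH2].
- by rewrite nform_normal linX SubK.
- rewrite (nform_square u' v' pa) lin_nel.
  have -> : u ++ (u' ++ a :: a :: v') ++ v = (u ++ u') ++ a :: a :: v' ++ v.
    by rewrite -!catA.
  rewrite (nform_square (u ++ u') (v' ++ v) pa); apply: eq_lin => c _.
  by rewrite IH -!catA.
rewrite (nform_swap u' v' a b) linearD linearZ /= IH1 lin_nel.
have h c d : u ++ (u' ++ c :: d :: v') ++ v = (u ++ u') ++ c :: d :: v' ++ v.
  by rewrite -!catA.
rewrite !h.
rewrite (nform_swap (u ++ u') (v' ++ v) a b).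
have -> : nel (u ++ u') (v' ++ v) (br (e a) (e b)) = lin (fun c => lin (fun n : N =>
  nform (u ++ \val n ++ v)) (nform (u' ++ c :: v'))) (co (br (e a) (e b))).
  by apply: eq_lin => c _; rewrite IH2 -!catA.
done.
Qed.

Lemma lin_neq0 (T T' : choiceType) (F : T -> {malg K[T']}) x n :
  (lin F x)@_n != 0 -> exists2 k, x@_k != 0 & (F k)@_n != 0.
Proof.
move=> nz; have [k kx nzk] : exists2 k, k \in msupp x & (x@_k *: F k)@_n != 0.
  apply/hasP; apply: contraNT nz => /hasPn h.
  rewrite /lin raddf_sum big_seq big1 // => k /h; rewrite negbK => /eqP //.
exists k; first by rewrite mcoeff_neq0.
by move: nzk; rewrite mcoeffZ mulf_eq0 negb_or => /andP[].
Qed.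

Definition wpar (w : seq X) := foldr (fun x q => pX x (+) q) false w.

Lemma wpar_cat u v : wpar (u ++ v) = wpar u (+) wpar v.
Proof. by elim: u => //= x u ->; rewrite addbA. Qed.

Lemma wpar_cons x v : wpar (x :: v) = pX x (+) wpar v.
Proof. by []. Qed.

(** Neither rule lengthens a word, and [a, b] and Q(a) have the parity of the pair they replace.
    Length yields the filtration of [U], parity its grading. *)
Lemma nform_supp w (n : N) : (nform w)@_n != 0 ->
  (size (val n) <= size w)%N /\ wpar (val n) = wpar w.
Proof.
elim/(word_ind SB): w => [w nw|u a v pa IH|u a b v IH1 IH2].
- rewrite nform_normal mcoeffU.
  by have [<- _|_] := eqVneq (Sub w nw : N) n; rewrite ?SubK ?eqxx.
- rewrite (nform_square u v pa) => /lin_neq0[c /(sb_Q_par SB pa) pc /IH [le_n ->]].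
  split; first by apply: leq_trans le_n _; rewrite !size_cat /=; lia.
  by rewrite !wpar_cat !wpar_cons pc pa; case: (wpar v).
rewrite (nform_swap u v a b) coefD coefZ;
  have [->|nz] := eqVneq (nform (u ++ [:: b, a & v]))@_n 0.
  rewrite mulr0 add0r => /lin_neq0[c /(sb_par SB) pc /IH2[le_n ->]].
  split; first by apply: leq_trans le_n _; rewrite !size_cat /=; lia.
  by rewrite !wpar_cat !wpar_cons pc -!addbA.
move=> _; have [le_n ->] := IH1 nz; split.
  by apply: leq_trans le_n _; rewrite !size_cat.
by rewrite !wpar_cat !wpar_cons (addbCA (pX a)).
Qed.

Definition amul : A -> A -> A := locked_with nform_key (fun x y =>
  lin (fun m : N => lin (fun n : N => nform (val m ++ val n)) y) x).
Lemma amulE x y :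
  amul x y = lin (fun m : N => lin (fun n : N => nform (val m ++ val n)) y) x.
Proof. by rewrite /amul locked_withE. Qed.
Definition aone : A := nform [::].

Lemma amul_nform u v : amul (nform u) (nform v) = nform (u ++ v).
Proof.
rewrite amulE -[RHS](nform_concat [::] v u); apply: eq_lin => m _.
by have := nform_concat (val m) [::] v; rewrite !cats0 => <-; apply: eq_lin => n _;
  rewrite cats0.
Qed.

Lemma amul_is_bilinear :
  (forall x, linear (amul x)) /\ (forall y, linear (amul^~ y)).
Proof.
split=> [x|y] a z t; rewrite !amulE; last exact: linearP.
by rewrite -linZ -linD; apply: eq_lin => m _; rewrite linearP.
Qed.

Lemma alg_ind (P : A -> Prop) : P 0 -> (forall a x y, P x -> P y -> P (a *: x + y)) ->
  (forall n : N, P (nform (val n))) -> forall x, P x.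
Proof.
move=> P0 PD PX x; rewrite -[x]lin_id /lin.
elim: (enum_fset (msupp x)) => [|n s IH]; first by rewrite big_nil.
by rewrite big_cons; apply: PD => //; rewrite -nform_val.
Qed.

Lemma amulDl : left_distributive amul +%R.
Proof. by move=> x y z; have := amul_is_bilinear.2 z 1 x y; rewrite !scale1r. Qed.
Lemma amulDr : right_distributive amul +%R.
Proof. by move=> x y z; have := amul_is_bilinear.1 x 1 y z; rewrite !scale1r. Qed.
Lemma amulZl a x y : a *: amul x y = amul (a *: x) y.
Proof. by rewrite (scalable_linear (amul_is_bilinear.2 y)). Qed.
Lemma amulZr a x y : a *: amul x y = amul x (a *: y).
Proof. by rewrite (scalable_linear (amul_is_bilinear.1 x)). Qed.
Lemma amul0l x : amul 0 x = 0. Proof. by have := amulZl 0 0 x; rewrite !scale0r. Qed.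
Lemma amul0r x : amul x 0 = 0.
Proof. by have := amulZr 0 x 0; rewrite !scale0r. Qed.

Lemma amulPl a x x' y : amul (a *: x + x') y = a *: amul x y + amul x' y.
Proof. exact: (amul_is_bilinear.2 y a x x'). Qed.
Lemma amulPr x a y y' : amul x (a *: y + y') = a *: amul x y + amul x y'.
Proof. exact: (amul_is_bilinear.1 x a y y'). Qed.

Lemma amulA : associative amul.
Proof.
move=> x y z; elim/alg_ind: x => [|a x x' IH IH'|l].
- by rewrite (amul0l y) (amul0l z) amul0l.
- rewrite (amulPl a x x' y) (amulPl a x x' (amul y z)).
  by rewrite (amulPl a (amul x y) (amul x' y) z) IH IH'.
elim/alg_ind: y => [|a y y' IH IH'|m].
- by rewrite (amul0l z) (amul0r (nform _)) amul0l.
- rewrite (amulPl a y y' z) (amulPr (nform _) a (amul y z)) (amulPr (nform _) a y y').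
  by rewrite (amulPl a (amul _ y) (amul _ y') z) IH IH'.
elim/alg_ind: z => [|a z z' IH IH'|n].
- by rewrite (amul0r (nform (val m))) (amul0r (nform (val l))) amul0r.
- rewrite (amulPr (nform (val m)) a z z') (amulPr (amul _ _) a z z').
  by rewrite (amulPr (nform (val l)) a (amul _ z) (amul _ z')) IH IH'.
by rewrite (amul_nform (val m)) (amul_nform (val l) (val m)) !amul_nform catA.
Qed.

Lemma amul1 : left_id aone amul.
Proof.
move=> x; elim/alg_ind: x => [|a x x' IH IH'|n]; first exact: amul0r.
  by rewrite (amulPr aone a x x') IH IH'.
exact: amul_nform.
Qed.

Lemma amulr1 : right_id aone amul.
Proof.
move=> x; elim/alg_ind: x => [|a x x' IH IH'|n]; first exact: amul0l.
  by rewrite (amulPl a x x' aone) IH IH'.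
by rewrite amul_nform cats0.
Qed.

Lemma aone_neq0 : aone != 0.
Proof.
rewrite /aone (nform_normal (isT : normal [::])).
by rewrite monalgU_eq0 oner_eq0.
Qed.

HB.instance Definition _ := GRing.Zmodule_isNzRing.Build A
  amulA amul1 amulr1 amulDl amulDr aone_neq0.
HB.instance Definition _ := GRing.Lmodule_isLalgebra.Build K A amulZl.
HB.instance Definition _ := GRing.Lalgebra_isAlgebra.Build K A amulZr.

Lemma basis_homog x : homog pX co (pX x) (e x).
Proof.
move=> y; rewrite (sb_coe SB) mcoeffU.
by case: (eqVneq x y) => [->|]; rewrite //= eqxx.
Qed.

Lemma mul_nform u v : nform u * nform v = nform (u ++ v).
Proof. exact: amul_nform. Qed.

Definition inc : g -> A := locked_with nform_key (nel [::] [::]).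
Lemma incE : inc = nel [::] [::].
Proof. exact: locked_withE. Qed.

Lemma inc_linear : linear inc.
Proof. by move=> a x y; rewrite incE /nel linearP /= linearP. Qed.

Lemma inc_e x : inc (e x) = nform [:: x].
Proof. by rewrite incE /nel (sb_coe SB) linX. Qed.

Lemma inc_mul x y :
  inc x * inc y = lin (fun c => lin (fun d => nform [:: c; d]) (co y)) (co x).
Proof.
have E u : inc u = \sum_(c <- msupp (co u)) (co u)@_c *: nform [:: c].
  by rewrite incE.
rewrite !E /lin mulr_suml; apply: eq_bigr => c _.
rewrite -scalerAl mulr_sumr; congr (_ *: _); apply: eq_bigr => d _.
by rewrite -scalerAr (mul_nform [:: c] [:: d]).
Qed.

Lemma inc_br x y :
  inc (br x y) = lin (fun c => lin (fun d => inc (br (e c) (e d))) (co y)) (co x).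
Proof.
rewrite (br_suml SB) (linear_lin _ _ inc_linear); apply: eq_lin => c _ /=.
by rewrite (br_sumr SB) (linear_lin _ _ inc_linear).
Qed.

Lemma inc_comm a b x y : homog pX co a x -> homog pX co b y ->
  inc (br x y) = inc x * inc y - koszul a b *: (inc y * inc x).
Proof.
move=> hx hy; rewrite (inc_br x y) (inc_mul x y) (inc_mul y x) [X in _ - koszul a b
  *: X]lin_exchange.
rewrite -linZ -linB; apply: eq_lin => c hc; rewrite -linZ -linB.
apply: eq_lin => d hd; have := nform_swap [::] [::] c d.
by rewrite (hx _ hc) (hy _ hd) => /= ->; rewrite addrAC subrr add0r incE.
Qed.

Context (par : bool -> g -> Prop) (sq : g -> g).
Context (par_homog : forall q u, par q u <-> homog pX co q u).
Context (sq_e : forall x, pX x -> sq (e x) = Q x).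
(** A quadratic map is determined by its polarization and its values on a basis, so the square
    relation is checked on basis letters only. For currents this is [csq_rep]. *)
Context (sq_rep : forall (B : algType K) (f : g -> B), linear f ->
  (forall x y, par true x -> par true y -> f (br x y) = f x * f y + f y * f x) ->
  (forall x, pX x -> f (Q x) = f (e x) ^+ 2) ->
  forall y, par true y -> f (sq y) = f y ^+ 2).

Lemma koszulM (B : algType K) a b (z : B) : (-1) ^+ (a && b) * z = koszul a b *: z.
Proof. by rewrite /koszul; case: (a && b);
  rewrite ?expr0 ?expr1 ?mul1r ?scale1r ?mulN1r ?scaleN1r. Qed.

Lemma inc_rep : lie_super_rep par br sq inc.
Proof.
have comm a b x y : par a x -> par b y ->
  inc (br x y) = inc x * inc y - koszul a b *: (inc y * inc x).
  by move=> /par_homog hx /par_homog; apply: inc_comm.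
split; first exact: inc_linear.
  by move=> a b x y hx hy; rewrite koszulM; apply: comm.
apply: sq_rep; first exact: inc_linear.
  by move=> x y hx hy; rewrite (comm _ _ _ _ hx hy) /koszul /= scaleN1r opprK.
move=> x px; rewrite inc_e expr2 (mul_nform [:: x] [:: x]).
by rewrite (nform_square [::] [::] px) incE.
Qed.

Context (U : algType K) (iota : g -> U).
Context (HU : enveloping_superalgebra par br sq iota).

Local Notation word := (basis_word e iota).

Definition eval : A -> U := lin (fun n : N => word (val n)).

Lemma par_e x : par (pX x) (e x).
Proof. by apply/par_homog; exact: basis_homog. Qed.

Lemma iota_linear : linear iota.
Proof. by have [[]] := HU. Qed.

Let iota_linE := iota_lin (sb_lin SB) iota_linear.
Let word_midE := word_mid (sb_lin SB) iota_linear.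

Lemma iota_comm a b x y : par a x -> par b y ->
  iota x * iota y = koszul a b *: (iota y * iota x) + iota (br x y).
Proof.
have [[_ h _] _] := HU; move=> hx hy; rewrite (h _ _ _ _ hx hy) koszulM.
by rewrite addrCA subrr addr0.
Qed.

Lemma word_swap u v a b : word (u ++ a :: b :: v) =
  koszul (pX a) (pX b) *: word (u ++ b :: a :: v)
  + lin (fun c => word (u ++ c :: v)) (co (br (e a) (e b))).
Proof.
have h c d : word (u ++ c :: d :: v) = word u * (iota (e c) * iota (e d)) * word v.
  by rewrite word_cat !word_cons !mulrA.
rewrite !h (iota_comm (par_e a) (par_e b)) mulrDr mulrDl word_midE.
by rewrite -scalerAr -scalerAl.
Qed.

Lemma word_square u v a : pX a ->
  word (u ++ a :: a :: v) = lin (fun c => word (u ++ c :: v)) (co (Q a)).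
Proof.
move=> pa; rewrite -word_midE -(sq_e pa); have [[_ _ h] _] := HU.
rewrite h; last by have := par_e a; rewrite pa.
by rewrite word_cat !word_cons expr2 !mulrA.
Qed.

Lemma eval_linear : linear eval. Proof. exact: linearP. Qed.

(** Both rewriting rules are relations of [U], so evaluation does not see the reduction. *)
Lemma eval_nform w : eval (nform w) = word w.
Proof.
elim/(word_ind SB): w => [w nw|u a v pa IH|u a b v IH1 IH2].
- by rewrite nform_normal /eval linX.
- rewrite (nform_square u v pa) /eval lin_nel word_square //.
  by apply: eq_lin => c _; rewrite -IH.
rewrite (nform_swap u v a b) eval_linear IH1 (word_swap u v a b).
by congr (_ + _); rewrite /eval lin_nel; apply: eq_lin => c _; rewrite -IH2.
Qed.

Lemma eval_monoid : monoid_morphism eval.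
Proof.
split=> [|x y].
  by rewrite [1 in LHS](_ : _ = nform [::]) // eval_nform word_nil.
have evZ a z : eval (a *: z) = a *: eval z by exact: (scalable_linear eval_linear).
have ev0 : eval 0 = 0 by have := evZ 0 0; rewrite !scale0r.
elim/alg_ind: x => [|a x x' IH IH'|m]; first by rewrite mul0r ev0 mul0r.
  by rewrite mulrDl -scalerAl !eval_linear IH IH' mulrDl scalerAl.
elim/alg_ind: y => [|a y y' IH IH'|n]; first by rewrite mulr0 ev0 mulr0.
  by rewrite mulrDr -scalerAr !eval_linear IH IH' mulrDr scalerAr.
by rewrite mul_nform !eval_nform word_cat.
Qed.

HB.instance Definition _ := GRing.isLinear.Build K A U _ eval eval_linear.
HB.instance Definition _ := GRing.isMonoidMorphism.Build A U eval eval_monoid.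

(** The universal property gives [phi] from [U] to the model with [phi (word w) = nform w]. By
    uniqueness for maps from [U] to itself [eval] is a left inverse, so [phi] serves as the
    coordinate map. *)
Theorem pbw : exists c : {linear U -> {malg K[N]}},
  [/\ forall n, c (word (val n)) = << n >>,
      forall u, lin (fun n : N => word (val n)) (c u) = u
    & forall w (n : N), (c (word w))@_n != 0 ->
        (size (val n) <= size w)%N /\ wpar (val n) = wpar w].
Proof.
have [iota_rep univ] := HU.
have [phi [phi_iota _]] := univ _ _ inc_rep.
have phiM x y : phi (x * y) = phi x * phi y by exact: rmorphM.
have phi1 : phi 1 = 1 by exact: rmorph1.
have phi_word w : phi (word w) = nform w.
  elim: w => [|x w IH]; first by rewrite word_nil phi1.
  by rewrite (word_cat e iota [:: x] w) phiM IH word1 phi_iota inc_e mul_nform.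
have [phi' [_ uniq_phi']] := univ _ _ iota_rep.
have phiK u : eval (phi u) = u.
  have h1 : (eval \o phi : {lrmorphism U -> U}) =1 phi'.
    apply: uniq_phi' => x /=; rewrite phi_iota incE /nel /eval.
    rewrite lin_comp iota_linE; apply: eq_lin => c _ /=.
    by rewrite -/(eval _) eval_nform word1.
  have h2 : (idfun : {lrmorphism U -> U}) =1 phi' by apply: uniq_phi'.
  by have := h2 u; rewrite -h1.
exists (phi : {linear U -> A}); split.
- by move=> n; exact: etrans (phi_word _) (nform_val n).
- exact: phiK.
by move=> w n; have := @nform_supp w n; rewrite -phi_word.
Qed.

End PBWAlgebra.

(** * Leading terms *)

Section Filtration.
Context (K : fieldType) (g : lmodType K) (X : choiceType).
Context (leX : rel X) (pX : pred X) (e : X -> g) (co : {linear g -> {malg K[X]}}).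
Context (br : g -> g -> g) (Q : X -> g) (SB : super_basis leX pX e co br Q).
Context (U : algType K) (iota : g -> U).
Local Notation N := (normal_word leX pX).
Local Notation word := (basis_word e iota).
Local Notation wpar := (wpar pX).
Local Notation homog := (homog pX co).
Context (iota_linear : linear iota).
Context (iota_comm : forall a b x y, homog a x -> homog b y ->
  iota x * iota y = koszul a b *: (iota y * iota x) + iota (br x y)).
Context (c : {linear U -> {malg K[N]}}).
Context (c_word : forall n : N, c (word (val n)) = << n >>).
Context (c_lin : forall u, lin (fun n : N => word (val n)) (c u) = u).
Context (c_supp : forall w (n : N), (c (word w))@_n != 0 ->
        (size (val n) <= size w)%N /\ wpar (val n) = wpar w).

(* [Flt d] is the span of the words of length less than [d]. *)
Record Flt d (u : U) : Prop := InFlt {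
  FltP : forall n : N, (d <= size (val n))%N -> (c u)@_n = 0 }.

Lemma ucoefP a u v n : (c (a *: u + v))@_n = a * (c u)@_n + (c v)@_n.
Proof. by rewrite linearP mcoeffD mcoeffZ. Qed.

Lemma ucoefB u v n : (c (u - v))@_n = (c u)@_n - (c v)@_n.
Proof. by rewrite linearB mcoeffB. Qed.

Lemma ucoef_sum (I : Type) (s : seq I) (P : pred I) (F : I -> U) n :
  (c (\sum_(i <- s | P i) F i))@_n = \sum_(i <- s | P i) (c (F i))@_n.
Proof. by rewrite linear_sum raddf_sum. Qed.

Lemma ucoefZ a u n : (c (a *: u))@_n = a * (c u)@_n.
Proof. by rewrite linearZ mcoeffZ. Qed.

Lemma Flt_linear d a u v : Flt d u -> Flt d v -> Flt d (a *: u + v).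
Proof. by move=> [hu] [hv]; split=> n hn; rewrite ucoefP hu // hv // mulr0 addr0. Qed.

Lemma Flt0 d : Flt d 0.
Proof. by split=> n _; rewrite linear0 mcoeff0. Qed.

Lemma FltZ d a u : Flt d u -> Flt d (a *: u).
Proof. by move=> [hu]; split=> n hn; rewrite ucoefZ hu ?mulr0. Qed.

Lemma FltD d u v : Flt d u -> Flt d v -> Flt d (u + v).
Proof. by move=> hu hv; rewrite -[u]scale1r; apply: Flt_linear. Qed.

Lemma FltN d u : Flt d u -> Flt d (- u).
Proof. by rewrite -scaleN1r; apply: FltZ. Qed.

Lemma Flt_sum d (I : Type) (s : seq I) (P : pred I) (F : I -> U) :
  (forall i, P i -> Flt d (F i)) -> Flt d (\sum_(i <- s | P i) F i).
Proof. by move=> h; elim/big_ind: _ => //; [exact: Flt0|exact: FltD]. Qed.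

Lemma Flt_le d d' u : (d <= d')%N -> Flt d u -> Flt d' u.
Proof. by move=> le_d [hu]; split=> n hn; apply: hu; apply: leq_trans hn. Qed.

Lemma Flt_word d w : (size w < d)%N -> Flt d (word w).
Proof.
move=> lt; split=> n hn; apply/eqP; apply: contraTT hn => /c_supp[le_n _].
by rewrite -ltnNge; apply: leq_ltn_trans lt.
Qed.

Lemma Flt_ind d (P : U -> Prop) : P 0 ->
  (forall a u v, P u -> P v -> P (a *: u + v)) ->
  (forall w, (size w < d)%N -> P (word w)) -> forall u, Flt d u -> P u.
Proof.
move=> P0 PD Pw u [hu]; rewrite -(c_lin u) /lin big_seq.
elim/big_rec: _ => // n x hn Px; apply: PD => //; apply: Pw.
by rewrite ltnNge; apply: contraTN hn => /hu; rewrite -mcoeff_eq0 => ->.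
Qed.

Lemma Flt_bound u : exists d, Flt d u.
Proof.
exists (\max_(n <- msupp (c u)) size (val n)).+1%N; split=> n; apply: contraTeq.
rewrite mcoeff_neq0 -ltnNge ltnS => hn.
by apply: (@leq_bigmax_seq _ _ xpredT (fun n : N => size (val n)) n).
Qed.

(** The bounds are strict, so one factor may be a step longer: lengths at most d and below d' add up
    to below d + d'. *)
Lemma Flt_mull d d' u v : Flt d.+1 u -> Flt d' v -> Flt (d + d') (u * v).
Proof.
move=> hu hv; move: u hu.
apply: Flt_ind => [|a u u' hu hu'|w hw].
- by rewrite mul0r; apply: Flt0.
- by rewrite mulrDl -scalerAl; apply: Flt_linear.
move: v hv; apply: Flt_ind => [|a u u' hu hu'|w' hw'].
- by rewrite mulr0; apply: Flt0.
- by rewrite mulrDr -scalerAr; apply: Flt_linear.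
by rewrite -word_cat; apply: Flt_word; rewrite size_cat; lia.
Qed.

Lemma Flt_mulr d d' u v : Flt d u -> Flt d'.+1 v -> Flt (d + d') (u * v).
Proof.
move=> hu hv; move: u hu.
apply: Flt_ind => [|a u u' hu hu'|w hw].
- by rewrite mul0r; apply: Flt0.
- by rewrite mulrDl -scalerAl; apply: Flt_linear.
move: v hv; apply: Flt_ind => [|a u u' hu hu'|w' hw'].
- by rewrite mulr0; apply: Flt0.
- by rewrite mulrDr -scalerAr; apply: Flt_linear.
by rewrite -word_cat; apply: Flt_word; rewrite size_cat; lia.
Qed.

Lemma Flt_eq d u v (n : N) : Flt d (u - v) -> (d <= size (val n))%N ->
  (c u)@_n = (c v)@_n.
Proof. by move=> [h] /h /eqP; rewrite ucoefB subr_eq0 => /eqP. Qed.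

Lemma Flt_trans d u v w : Flt d (u - v) -> Flt d (v - w) -> Flt d (u - w).
Proof. by move=> h1 h2; rewrite -(subrKA v); apply: FltD. Qed.

Let word_midE := word_mid (sb_lin SB) iota_linear.

Lemma Flt_mid u v x : Flt (size u + size v).+2 (word u * iota x * word v).
Proof.
rewrite word_midE; apply: Flt_sum => y _; apply: FltZ; apply: Flt_word.
by rewrite size_cat /=; lia.
Qed.

Lemma Flt_iota x : Flt 2 (iota x).
Proof. by have := Flt_mid [::] [::] x; rewrite word_nil mulr1 mul1r. Qed.

Let homog_e x : homog (pX x) (e x). Proof. exact: (basis_homog SB). Qed.

Lemma word_swap_mod u a b v : Flt (size u + size v).+2
  (word (u ++ a :: b :: v) - koszul (pX a) (pX b) *: word (u ++ b :: a :: v)).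
Proof.
have h x y : word (u ++ x :: y :: v) = word u * (iota (e x) * iota (e y)) * word v.
  by rewrite word_cat !word_cons !mulrA.
rewrite !h (iota_comm (@homog_e a) (@homog_e b)) mulrDr mulrDl.
by rewrite -scalerAr -scalerAl addrAC subrr add0r; apply: Flt_mid.
Qed.

Lemma word_move_end u a v : Flt (size u + size v).+1
  (word (u ++ a :: v) - koszul (pX a) (wpar v) *: word (u ++ v ++ [:: a])).
Proof.
elim: v u => [|b v IH] u.
  by rewrite /koszul /= andbF expr0 scale1r subrr; apply: Flt0.
apply: (@Flt_trans _ _ (koszul (pX a) (pX b) *: word (u ++ b :: a :: v))).
  by apply: Flt_le _ (word_swap_mod u a b v); rewrite /=; lia.
have := IH (rcons u b); rewrite !cat_rcons => /(FltZ (koszul (pX a) (pX b))).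
rewrite scalerBr scalerA koszulM_addb size_rcons => h.
by apply: Flt_le _ h; rewrite /=; lia.
Qed.

Lemma even_par w : all (predC pX) w -> wpar w = false.
Proof. by elim: w => //= x w IH /andP[/negPf -> /IH ->]. Qed.

(** Swapping even letters has sign 1 and costs only shorter words, so in the associated graded
    algebra only the multiset of letters counts. *)
Lemma word_perm w w' : all (predC pX) w -> perm_eq w w' ->
  Flt (size w) (word w - word w').
Proof.
have front u a v : ~~ pX a -> Flt (size u +
  size v).+1 (word (u ++ a :: v) - word (a :: u ++ v)).
  move=> pa; elim/last_ind: u v => [|u b IH] v; first by rewrite subrr; apply: Flt0.
  rewrite !cat_rcons; apply: (@Flt_trans _ _ (word (u ++ a :: b :: v))).
    have := word_swap_mod u b a v.
    rewrite {1}/koszul (negPf pa) andbF expr0 scale1r size_rcons => h.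
    by apply: Flt_le _ h; lia.
  by apply: Flt_le _ (IH (b :: v)); rewrite size_rcons /=; lia.
elim: w w' => [|a w IH] w' /=.
  by move=> _ /perm_size /esym /size0nil ->; rewrite subrr; apply: Flt0.
case/andP => pa evw peq; have aw' : a \in w' by rewrite -(perm_mem peq) mem_head.
case/splitPr: w' / aw' peq => w1 w2 peq.
have {}peq : perm_eq w (w1 ++ w2).
  rewrite -(perm_cons a); apply: perm_trans peq _.
  exact: permEl (perm_catCA w1 [:: a] w2).
apply: (@Flt_trans _ _ (word (a :: w1 ++ w2))).
  rewrite !word_cons -mulrBr -add1n; apply: Flt_mull _ (IH _ evw peq).
  exact: Flt_iota.
rewrite -opprB; apply: FltN; apply: Flt_le _ (front w1 a w2 pa).
by rewrite (perm_size peq) size_cat.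
Qed.

(** Each occurrence of a letter is listed separately, so that sums over [splits] count
    multiplicities, as a formal derivative does. *)
Fixpoint splits (w : seq X) : seq (seq X * X * seq X) :=
  if w is x :: w' then
    ([::], x, w') :: [seq (x :: s.1.1, s.1.2, s.2) | s <- splits w']
  else [::].

Lemma splitsP w s : s \in splits w -> w = s.1.1 ++ s.1.2 :: s.2.
Proof.
elim: w s => //= x w IH s; rewrite inE => /predU1P[-> //|].
by case/mapP => t /IH -> ->.
Qed.

(** The super Leibniz rule; the sign comes from carrying y leftwards past the letters behind the one
    it is bracketed with. *)
Lemma commutator_word w y q : homog q y ->
  word w * iota y - koszul (wpar w) q *: (iota y * word w) =
  \sum_(s <- splits w) koszul (wpar s.2) q *:
     (word s.1.1 * iota (br (e s.1.2) y) * word s.2).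
Proof.
move=> hy; elim: w => [|x w IH].
  by rewrite big_nil word_nil mulr1 mul1r /koszul /= expr0 scale1r subrr.
rewrite big_cons big_map /= word_nil mul1r !word_cons.
have -> : \sum_(s <- splits w) koszul (wpar s.2) q *:
    (word (x :: s.1.1) * iota (br (e s.1.2) y) * word s.2) =
    iota (e x) * (word w * iota y - koszul (wpar w) q *: (iota y * word w)).
  rewrite IH mulr_sumr; apply: eq_bigr => s _.
  by rewrite -scalerAr word_cons !mulrA.
have -> : iota (br (e x) y) = iota (e x) * iota y - koszul (pX x) q *: (iota y * iota
  (e x)).
  by rewrite (iota_comm (@homog_e x) hy) addrAC subrr add0r.
have -> : koszul (pX x (+) wpar w) q = koszul (wpar w) q * koszul (pX x) q :> K.
  by rewrite !(koszulC _ q) koszulM_addb addbC.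
move: (iota (e x)) (word w) (iota y) (koszul _ q) (koszul _ q) => E W Y s1 s2.
rewrite mulrBl scalerBr mulrBr -!scalerAl -!scalerAr !mulrA scalerA.
by rewrite [RHS]addrC addrA subrK.
Qed.

Lemma normal_rcons w x : normal leX pX w ->
  {in w, forall a, good leX pX a x} -> normal leX pX (rcons w x).
Proof.
rewrite /normal -cats1; elim: w => //= a w IH pw h.
have hw : {in w, forall b, good leX pX b x} by move=> b bw; apply: h; rewrite inE bw orbT.
case: w => [|b w] /= in pw h hw IH *; first by rewrite h ?inE.
by move: pw => /andP[-> /IH ->].
Qed.

Lemma sum_msupp_pick (f : {malg K[X]}) (G : X -> K) y :
  \sum_(t <- msupp f) f@_t * G t *+ (t == y) = f@_y * G y.
Proof.
rewrite [f in RHS]monalgE raddf_sum mulr_suml; apply: eq_bigr => t _ /=.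
by rewrite mcoeffU; case: eqVneq => [->|_] //; rewrite !mulr0n mul0r.
Qed.

(* The sum is the coefficient of the normal word [rcons m y] in the supercommutator
   of z and [e b], in degree [d]. By the last hypothesis the letters of the
   brackets exceed all letters of z, so moving them to the end of a word leads to
   a normal word. *)
Lemma top_identity z q b d : Flt d.+1 z ->
  (forall n, (c z)@_n != 0 -> wpar (val n) = q) ->
  z * iota (e b) = koszul q (pX b) *: (iota (e b) * z) ->
  (forall n n' x a y, (c z)@_n != 0 -> (c z)@_n' != 0 -> x \in val n ->
    a \in val n' -> (co (br (e x) (e b)))@_y != 0 -> good leX pX a y) ->
  forall m y, \sum_(n <- msupp (c z))
    \sum_(s <- splits (val n) | (size (val n) == d) && (s.1.1 ++ s.2 == m))
      (c z)@_n * (koszul (pX s.1.2) (wpar s.2) * (co (br (e s.1.2) (e b)))@_y) = 0.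
Proof.
move=> [hz] zpar zcomm fresh m y.
pose F s : U := word s.1.1 * iota (br (e s.1.2) (e b)) * word s.2.
have E0 : \sum_(n <- msupp (c z)) (c z)@_n *:
    \sum_(s <- splits (val n)) koszul (wpar s.2) (pX b) *: F s = 0.
  transitivity (z * iota (e b) - koszul q (pX b) *: (iota (e b) * z)).
    rewrite -[in RHS](c_lin z) /lin mulr_suml mulr_sumr scaler_sumr -sumrB.
    apply: eq_big_seq => n; rewrite -mcoeff_neq0 => /zpar <-.
    rewrite -(commutator_word _ (@homog_e b)) scalerBr -scalerAl -scalerAr.
    by rewrite !scalerA [_ * koszul _ _]mulrC.
  by rewrite zcomm subrr.
have szn n : n \in msupp (c z) -> (size (val n) <= d)%N.
  by rewrite -mcoeff_neq0 leqNgt; apply: contraNN => /hz ->.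
have nrm n s t : n \in msupp (c z) -> s \in splits (val n) ->
    (co (br (e s.1.2) (e b)))@_t != 0 -> normal leX pX (rcons (s.1.1 ++ s.2) t).
  rewrite -mcoeff_neq0 => zn /splitsP en ht; apply: normal_rcons.
    apply: (subseq_sorted (good_trans (sb_anti SB) (sb_trans SB))) (valP n).
    by rewrite en cat_subseq // subseq_cons.
  move=> a ha; apply: (fresh n n s.1.2) => //; rewrite en ?mem_cat ?inE ?eqxx ?orbT //.
  by move: ha; rewrite mem_cat => /orP[] ->; rewrite ?orbT.
case: (boolP (normal leX pX (rcons m y) && ((size m).+1 == d))) => [/andP[nm /eqP em]|no].
  pose M : N := Sub (rcons m y) nm.
  have szM : size (val M) = d by rewrite SubK size_rcons.
  have := congr1 (fun u => (c u)@_M) E0; rewrite ucoef_sum linear0 mcoeff0 => E1.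
  rewrite -[RHS]E1; apply: eq_big_seq => n hn.
  rewrite ucoefZ ucoef_sum mulr_sumr big_mkcond; apply: eq_big_seq => s hs.
  rewrite ucoefZ.
  have en := splitsP hs; have size_n : size (val n) = (size s.1.1 + size s.2).+1.
    by rewrite en size_cat /= addnS.
  (* Words of [z] shorter than d do not grow under bracketing and miss the coefficient of [M], which
     has length d. *)
  case: eqP => [sd|nd] /=; last first.
    rewrite (FltP (Flt_mid s.1.1 s.2 (br (e s.1.2) (e b)))) ?mulr0 //.
    by rewrite szM; have := szn n hn; rewrite leq_eqVlt => /predU1P[/nd //|];
      rewrite size_n.
  rewrite /F word_midE /lin ucoef_sum.
  (* Moved to the end, the new letter t completes a normal word by [nrm], so its coefficient is read
     off directly; the move leaves only shorter words behind. *)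
  have step t : (c ((co (br (e s.1.2) (e b)))@_t *: word (s.1.1 ++ t :: s.2)))@_M =
      (co (br (e s.1.2) (e b)))@_t * koszul (pX t) (wpar s.2) *+ (rcons (s.1.1 ++
        s.2) t == rcons m y).
    rewrite ucoefZ; have [->|nz] := eqVneq (co (br (e s.1.2) (e b)))@_t 0.
      by rewrite !mul0r mul0rn.
    rewrite (Flt_eq (word_move_end s.1.1 t s.2)); last by rewrite szM -sd size_n.
    rewrite ucoefZ catA cats1.
    have nt := nrm n s t hn hs nz.
    rewrite -[rcons _ _ in LHS](SubK N nt) c_word mcoeffU.
    by rewrite -val_eqE /= mulrnAr mulr1 mulrnAr.
  rewrite (eq_bigr _ (fun t _ => step t)).
  case: (eqVneq (s.1.1 ++ s.2) m) => [->|nm']; last first.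
    rewrite big1 ?mulr0 // => t _.
    by rewrite eqseq_rcons (negPf nm').
  rewrite (eq_bigr (fun t => (co (br (e s.1.2) (e b)))@_t * koszul (pX t) (wpar s.2)
    *+ (t == y))); last first.
    by move=> t _; rewrite eqseq_rcons eqxx.
  rewrite (sum_msupp_pick _ (fun t => koszul (pX t) (wpar s.2))).
  have [->|nz] := eqVneq (co (br (e s.1.2) (e b)))@_y 0; first by rewrite !(mulr0, mul0r).
  (* The letter y has the parity of [x, e_b] for the deleted letter x; the signs involving b cancel,
     and the sign of x against the letters behind it is left. *)
  rewrite (sb_par SB nz) (mulrCA _ (co _)@_y) (koszulC (_ (+) _)) koszulM_addb addbC
    addbK.
  by rewrite (koszulC (wpar _)) [X in _ * X = _]mulrC.
(* Otherwise every term is zero: a nonzero one would make [rcons m y] normal of length d. *)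
rewrite big_seq big1 // => n hn;
  rewrite big_seq_cond big1 // => s /and3P[hs /eqP sn /eqP em].
have [->|nz] := eqVneq (co (br (e s.1.2) (e b)))@_y 0; first by rewrite !mulr0.
case/negP: no; rewrite -em (nrm n s y) //= -sn {1}(splitsP hs) !size_cat /=.
by rewrite addnS.
Qed.

End Filtration.

(** * Generators whose leading words are powers of letters *)

Definition repeat_word (J X : eqType) (f : J -> nat) (t : J -> X) (s : seq J) : seq X :=
  flatten [seq nseq (f k) (t k) | k <- s].

Lemma count_repeat_word (J X : eqType) (f : J -> nat) (t : J -> X) s y :
  count_mem y (repeat_word f t s) = (\sum_(k <- s) f k * (t k == y))%N.
Proof.
rewrite /repeat_word; elim: s => [|k s IH] /=; first by rewrite big_nil.
by rewrite count_cat IH count_nseq big_cons mulnC.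
Qed.

Lemma count_repeat_id (X : eqType) (f : X -> nat) s (y : X) :
  count_mem y (repeat_word f id s) = (f y * count_mem y s)%N.
Proof.
rewrite count_repeat_word; elim: s => [|k s IH] /=.
  by rewrite big_nil muln0.
by rewrite big_cons IH mulnDr; case: eqP => [->|]; rewrite ?muln0.
Qed.

Lemma prod_repeat_word (R : pzRingType) (J X : eqType) (f : J -> nat) (t :
  J -> X) s (F : X -> R) :
  \prod_(x <- repeat_word f t s) F x = \prod_(k <- s) F (t k) ^+ f k.
Proof.
rewrite /repeat_word; elim: s => [|k s IH] /=; first by rewrite !big_nil.
by rewrite big_cat big_cons IH big_nseq iter_mulr_1.
Qed.

Lemma all_repeat_word (J X : eqType) (f : J -> nat) (t : J -> X) s (a : pred X) :
  {in s, forall k, a (t k)} -> all a (repeat_word f t s).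
Proof.
move=> h; apply/allP => x /flattenP[w /mapP[k ks ->]] /nseqP[-> _].
exact: h.
Qed.

Section Generators.
Context (K : fieldType) (g : lmodType K) (X : choiceType).
Context (leX : rel X) (pX : pred X) (e : X -> g) (co : {linear g -> {malg K[X]}}).
Context (br : g -> g -> g) (Q : X -> g) (SB : super_basis leX pX e co br Q).
Context (U : algType K) (iota : g -> U).
Local Notation N := (normal_word leX pX).
Local Notation word := (basis_word e iota).
Local Notation homog := (homog pX co).
Context (iota_linear : linear iota).
Context (iota_comm : forall a b x y, homog a x -> homog b y ->
  iota x * iota y = koszul a b *: (iota y * iota x) + iota (br x y)).
Context (c : {linear U -> {malg K[N]}}).
Context (c_word : forall n : N, c (word (val n)) = << n >>).
Context (c_lin : forall u, lin (fun n : N => word (val n)) (c u) = u).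
Context (c_supp : forall w (n : N), (c (word w))@_n != 0 ->
        (size (val n) <= size w)%N /\ wpar pX (val n) = wpar pX w).
Context (wt : X -> nat) (gen : X -> U) (D : {pred X}).
Context (evenD : {in D, forall x, ~~ pX x}).
Context (wt_gt0 : forall x, (0 < wt x)%N).
Local Notation Flt := (Flt c).
Context (gen_top : {in D, forall x, Flt (wt x) (gen x - word (nseq (wt x) x))}).

Let Flt_word' := Flt_word c_supp.

Lemma gen_prod s : all [in D] s ->
  Flt (size (repeat_word wt id s))
    (\prod_(x <- s) gen x - word (repeat_word wt id s)).
Proof.
elim: s => [_|x s IH /= /andP[xD sD]].
  by rewrite big_nil /repeat_word /= word_nil subrr; apply: Flt0.
rewrite big_cons /repeat_word /= -/(repeat_word _ _ _) size_cat size_nseq word_cat.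
have -> (a b a' b' : U) : a * b - a' * b' = a * (b - b') + (a - a') * b'.
  by rewrite mulrBr mulrBl addrA subrK.
apply: FltD.
  apply: Flt_mull => //; last exact: IH.
  rewrite -(subrK (word (nseq (wt x) x)) (gen x)); apply: FltD.
    by apply: Flt_le (gen_top xD).
  by apply: Flt_word'; rewrite size_nseq.
by apply: Flt_mulr => //; [exact: gen_top | exact: Flt_word'].
Qed.

Lemma normal_sort w : all (predC pX) w -> normal leX pX (sort leX w).
Proof.
move=> ev; have : sorted leX (sort leX w) := sort_sorted (sb_total SB) w.
have : all (predC pX) (sort leX w) by rewrite all_sort.
rewrite /normal; elim: (sort leX w) => //= a s IH /andP[pa ps].
case: s => [|b s] //= in ps IH * => /andP[ab sb].
by rewrite /good ab pa orbT /=; apply: IH.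
Qed.

(** The leading letters are even, so the leading word may be sorted; the sorted word is normal and
    is the only one of top length. *)
Lemma gen_prod_coef s (M : N) : all [in D] s ->
  (size (repeat_word wt id s) <= size (val M))%N ->
  (c (\prod_(x <- s) gen x))@_M = (perm_eq (val M) (repeat_word wt id s))%:R.
Proof.
move=> sD szM; rewrite (Flt_eq (gen_prod sD) szM).
set w := repeat_word wt id s.
have evw : all (predC pX) w.
  by apply: all_repeat_word => x xs; apply: evenD; apply: (allP sD).
have hp : perm_eq w (sort leX w) by rewrite perm_sym perm_sort.
rewrite (Flt_eq (word_perm SB iota_linear iota_comm c_lin c_supp evw hp)) //.
have nw := normal_sort evw.
rewrite -[sort leX w in LHS](SubK N nw) c_word mcoeffU; congr (_ *+ nat_of_bool _).
rewrite -val_eqE /=; apply/idP/idP => [/eqP <-|pM]; first by rewrite perm_sort.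
have := normal_uniq_perm (sb_anti SB) (sb_trans SB) nw (valP M).
by move=> ->; rewrite ?eqxx // perm_sort perm_sym.
Qed.

Lemma perm_repeat_count s s' : perm_eq (repeat_word wt id s) (repeat_word wt id s') ->
  forall x, count_mem x s = count_mem x s'.
Proof.
move=> /permP h x; have := h (pred1 x); rewrite !count_repeat_id => /eqP.
by rewrite eqn_pmul2l // => /eqP.
Qed.

(** A term with a longest leading word cannot cancel: any other leading word is no longer and, by
    the injectivity hypothesis, has different multiplicities. *)
Lemma gen_prod_free (J : eqType) (r : seq J) (S : J -> seq X) (a : J -> K) :
  uniq r -> (forall m, all [in D] (S m)) -> {in r, forall m, a m != 0} ->
  (forall m m', (forall x, count_mem x (S m) = count_mem x (S m')) -> m = m') ->
  \sum_(m <- r) a m *: \prod_(x <- S m) gen x = 0 -> r = [::].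
Proof.
move=> uniq_r allS nza Sinj hS; pose W m := repeat_word wt id (S m).
have [//|nzr] := eqVneq r [::]; suff : False by [].
have [m0 m0r max0] : exists2 m0, m0 \in r &
    {in r, forall m, (size (W m) <= size (W m0))%N}.
  elim: r nzr {uniq_r nza hS} => // b s IH _.
  case: (eqVneq s [::]) => [->|/IH [m1 m1s h1]].
    by exists b; rewrite ?mem_head // => m; rewrite inE => /eqP ->.
  case: (leqP (size (W b)) (size (W m1))) => [le1|/ltnW le1].
    exists m1; first by rewrite inE m1s orbT.
    by move=> m; rewrite inE => /predU1P[->|/h1].
  exists b; first exact: mem_head.
  by move=> m; rewrite inE => /predU1P[->|/h1 h] //; apply: leq_trans h _.
have evW : all (predC pX) (W m0).
  by apply: all_repeat_word => x xs; apply: evenD; apply: (allP (allS m0)).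
pose M : N := Sub (sort leX (W m0)) (normal_sort evW).
have := congr1 (fun u => (c u)@_M) hS; rewrite ucoef_sum linear0 mcoeff0.
rewrite (bigD1_seq m0) //= [X in _ + X]big1_seq ?addr0; last first.
  move=> m /andP[nm mr]; rewrite ucoefZ gen_prod_coef //; last first.
    by rewrite SubK size_sort; apply: max0.
  rewrite SubK; case: (boolP (perm_eq _ _)) => [hp|_]; last by rewrite mulr0.
  case/eqP: nm; apply/esym/Sinj/perm_repeat_count.
  by rewrite -/(W m0) -(permPl (permEl (perm_sort leX _))).
rewrite ucoefZ gen_prod_coef ?SubK ?size_sort // perm_sort perm_refl mulr1 => /eqP.
by rewrite (negPf (nza _ m0r)).
Qed.

Section AlgebraicIndependence.
Import mpoly.

Lemma gen_alg_independent : alg_independent D gen.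
Proof.
move=> n t tinj tD P hP.
(* Exponents become multiplicities of letters; as t is injective, [S m] determines m. *)
pose S (m : 'X_{1..n}) := repeat_word m t (enum 'I_n).
have countS m k : count_mem (t k) (S m) = m k.
  rewrite count_repeat_word big_enum (bigD1 k) //= eqxx muln1 big1 ?addn0 // => j jk.
  by rewrite (inj_eq tinj) (negPf jk) muln0.
apply/eqP; rewrite -msupp_eq0; apply/eqP.
apply: (gen_prod_free (S := S) (a := fun m => P@_m)).
- exact: msupp_uniq.
- by move=> m; apply: all_repeat_word => k _; apply: tD.
- by move=> m; rewrite mcoeff_msupp.
- by move=> m m' h; apply/mnmP => k; rewrite -!countS.
rewrite -[RHS]hP /mmap; apply: eq_bigr => m _.
by rewrite /mmap1 mulr_algl prod_repeat_word [index_enum _]unlock enumT.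
Qed.

End AlgebraicIndependence.

(** The condition on top words can be used again after each subtraction, because the subtracted
    combination of generator products lies in [Z] as well. *)
Lemma gen_generate (Z : U -> Prop) :
  (forall a u v, Z u -> Z v -> Z (a *: u + v)) ->
  (forall s, all [in D] s -> Z (\prod_(x <- s) gen x)) ->
  (forall z d (n : N), Z z -> Flt d.+1 z -> size (val n) = d -> (c z)@_n != 0 ->
     all [in D] (val n) /\ forall x, x \in val n -> (wt x %| count_mem x (val n))%N) ->
  forall z, Z z -> subalg (fun u => exists2 x, x \in D & u = gen x) z.
Proof.
move=> Zlin Zgen Ztop z; set G := fun u => _.
have Gprod s : all [in D] s -> subalg G (\prod_(x <- s) gen x).
  elim: s => [_|x s IH /= /andP[xD sD]]; first by rewrite big_nil; apply: SubalgOne.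
  by rewrite big_cons; apply: SubalgMul; [apply: SubalgGen; exists x | apply: IH].
have G0 : subalg G 0.
  have := SubalgLinear (-1) (SubalgOne G) (SubalgOne G).
  by rewrite scaleN1r addNr.
have [d] := Flt_bound c z; elim: d z => [|d IH] z hz Zz.
  rewrite -(c_lin z) /lin big1 // => n _.
  by rewrite (FltP hz) ?scale0r.
(* Dividing multiplicities by weights gives the exponents of the monomial in the generators whose
   leading word is n. *)
pose root (n : N) := repeat_word (fun x =>
  count_mem x (val n) %/ wt x)%N id (undup (val n)).
pose top := [seq n <- enum_fset (msupp (c z)) | size (val n) == d].
have topP n : n \in top -> [/\ size (val n) = d, all [in D] (root n)
    & perm_eq (repeat_word wt id (root n)) (val n)].
  rewrite mem_filter => /andP[/eqP sn];
    rewrite -[_ \in _]/(n \in msupp (c z)) -mcoeff_neq0 => nz.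
  have [nD dvd_n] := Ztop z d n Zz hz sn nz; split=> //.
    by apply: all_repeat_word => x; rewrite mem_undup => /(allP nD).
  have hc (x : X) : count_mem x (repeat_word wt id (root n)) = count_mem x (val n).
    rewrite count_repeat_id /root count_repeat_id (count_uniq_mem _ (undup_uniq _))
      mem_undup.
    case: (boolP (x \in val n)) => [/dvd_n dvd_x|/count_memPn ->].
      by rewrite muln1 mulnC divnK.
    by rewrite muln0 muln0.
  by apply/allP => x _; apply/eqP/hc.
pose z1 := \sum_(n <- top) (c z)@_n *: \prod_(x <- root n) gen x.
have Gsum (P : U -> Prop) : P 0 -> (forall a u v, P u -> P v -> P (a *: u + v)) ->
    (forall s, all [in D] s -> P (\prod_(x <- s) gen x)) -> P z1.
  move=> P0 Plin Pgen; rewrite /z1 big_seq; elim/big_rec: _ => // n u nt Pu.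
  by apply: Plin => //; apply: Pgen; have [] := topP n nt.
have Z0 : Z 0.
  by have := Zlin (-1) _ _ Zz Zz; rewrite scaleN1r addNr.
have G1 : subalg G z1 by apply: Gsum => // *; apply: SubalgLinear.
have Z1 : Z z1 by apply: Gsum.
have lower : Flt d (z - z1).
  split=> M szM; rewrite ucoefB ucoef_sum.
  have -> : \sum_(n <- top) (c ((c z)@_n *: \prod_(x <- root n) gen x))@_M =
      \sum_(n <- top) (c z)@_n *+ (n == M).
    apply: eq_big_seq => n nt; have [sn rD pn] := topP n nt.
    rewrite ucoefZ gen_prod_coef //; last by rewrite (perm_size pn) sn.
    rewrite mulr_natr; congr (_ *+ nat_of_bool _).
    rewrite (permPr pn) -val_eqE; apply/idP/eqP => [pM|-> //]; apply/esym.
    exact: (normal_uniq_perm (sb_anti SB) (sb_trans SB) (valP M) (valP n) pM).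
  case: (boolP (M \in top)) => [Mt|Mnt].
    have ut : uniq top by rewrite filter_uniq ?fset_uniq.
    rewrite (bigD1_seq M Mt ut) /= eqxx big1 ?addr0 ?subrr //.
    by move=> n /negPf ->.
  rewrite big_seq big1 ?subr0 => [|n nt]; last first.
    by case: eqP => // eM; rewrite -eM nt in Mnt.
  apply/eqP; apply: contraNT Mnt => nz; rewrite mem_filter.
  have -> : M \in enum_fset (msupp (c z)) by rewrite -[_ \in _]/(M \in msupp (c z))
    -mcoeff_neq0.
  rewrite andbT eqn_leq szM andbT -ltnS ltnNge; apply: contraNN nz => hM.
  by apply/eqP/(FltP hz).
have -> : z = 1 *: (z - z1) + z1 by rewrite scale1r subrK.
apply: SubalgLinear => //; apply: IH => //.
by rewrite addrC -scaleN1r; apply: Zlin.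
Qed.

End Generators.

(** * Current superalgebras *)

Section Coordinates.
Context (K : fieldType) (l : lmodType K) (I : choiceType) (e : I -> l).
Context (he : basis_on e predT (fun _ => True)).

Lemma basis_inj (f : {malg K[I]}) : lin e f = 0 -> f = 0.
Proof.
case: he => _ free _ h; apply/malgP => i; rewrite mcoeff0.
have [i_f|] := boolP (i \in msupp f); last exact: mcoeff_outdom.
by apply: (free (enum_fset (msupp f)) (fset_uniq _) _ (fun j => f@_j)).
Qed.

Lemma lin_seq (s : seq I) (a : I -> K) :
  \sum_(i <- s) a i *: e i = lin e (\sum_(i <- s) << a i *g i >>).
Proof. by rewrite linear_sum; apply: eq_bigr => i _; exact/esym/linU. Qed.

(** Spanning gives preimages under [lin e], picked by choice; injectivity makes them unique, hence
    linear in v. *)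
Lemma coordinates_exist : exists co : {linear l -> {malg K[I]}},
  (forall i, co (e i) = << i >>) /\ (forall v, lin e (co v) = v).
Proof.
have [_ _ span] := he.
have ex v : exists f : {malg K[I]}, lin e f = v.
  have [s [a [_ ->]]] := span v Logic.I.
  by exists (\sum_(i <- s) << a i *g i >>); rewrite lin_seq.
have [co coP] := boolp.choice ex.
have inj f h : lin e f = lin e h -> f = h.
  by move=> /eqP; rewrite -subr_eq0 -linearB => /eqP /basis_inj /eqP;
    rewrite subr_eq0 => /eqP.
have lco : linear co.
  by move=> a u v; apply: inj; rewrite linearP /= !coP.
pose m := GRing.isLinear.Build K l {malg K[I]} _ co lco.
pose co' : {linear l -> {malg K[I]}} := HB.pack co m.
exists co'; split=> [i|]; last exact: coP.
by apply: inj; rewrite linX; apply: coP.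
Qed.

Context (co : {linear l -> {malg K[I]}}).
Context (coe : forall i, co (e i) = << i >>) (lin_co : forall v, lin e (co v) = v).

(** Turns membership in the even part, the odd part or C(l) into a condition on coordinates. *)
Lemma basis_on_supp (A : {pred I}) (V : l -> Prop) : basis_on e A V ->
  forall v, V v -> forall i, (co v)@_i != 0 -> i \in A.
Proof.
move=> [_ _ span] v /span[s [a [sA ->]]] i; rewrite linear_sum raddf_sum.
apply: contraNT => iA; rewrite big_seq big1 // => j /sA jA.
rewrite linearZ /= coe mcoeffZ mcoeffU; case: eqVneq => [ji|]; last by rewrite mulr0.
by rewrite -ji jA in iA.
Qed.

End Coordinates.

Section CurrentLinear.
Context (K : fieldType) (S : nmodType) (l : lmodType K).
Implicit Types u v : current S l.

Lemma ccoefP a u v r : (a *: u + v)@_r = a *: u@_r + v@_r.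
Proof. by rewrite mcoeffD cscaleE. Qed.

Lemma cmonom_linear r : linear (fun x : l => << x *g r >> : current S l).
Proof.
move=> a x y; apply/malgP => s; rewrite ccoefP !mcoeffU.
by case: (r == s); rewrite ?mulr1n ?mulr0n // scaler0 addr0.
Qed.

Section Bracket.
Context (br : l -> l -> l).
Context (br_l : forall y, linear (br^~ y)) (br_r : forall x, linear (br x)).

Let br0l y : br 0 y = 0.
Proof. by have := scalable_linear (br_l y) 0 0; rewrite /= !scale0r. Qed.
Let br0r x : br x 0 = 0.
Proof. by have := scalable_linear (br_r x) 0 0; rewrite /= !scale0r. Qed.

(** Larger index sets are allowed so that the brackets of u, u' and a u + u' can be summed over a
    common one, which gives bilinearity. *)
Lemma cbrEw u v (d d' : {fset S}) : {subset msupp u <= d} -> {subset msupp v <= d'} ->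
  cbr br u v = \sum_(r <- d) \sum_(s <- d') << br u@_r v@_s *g r + s >>.
Proof.
move=> sd sd'; rewrite /cbr.
transitivity (\sum_(r <- msupp u) \sum_(s <- d') << br u@_r v@_s *g r + s >>).
  apply: eq_bigr => r _; apply: big_fset_incl; first exact/fsubsetP.
  by move=> s _ /mcoeff_outdom ->; rewrite br0r monalgU0.
apply: big_fset_incl; first exact/fsubsetP.
by move=> r _ /mcoeff_outdom ->; rewrite big1 // => s _; rewrite br0l monalgU0.
Qed.

Lemma msupp_cover (a : K) u v : exists d : {fset S},
  [/\ {subset msupp u <= d}, {subset msupp v <= d} & {subset msupp (a *: u + v) <= d}].
Proof.
exists (msupp u `|` msupp v `|` msupp (a *: u + v))%fset.
by split=> t ht; rewrite !inE ht ?orbT.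
Qed.

Lemma cbr_l v : linear ((@cbr K S l br)^~ v).
Proof.
move=> a u u'; have [d [s1 s2 s3]] := msupp_cover a u u'.
have sv : {subset msupp v <= msupp v} by [].
rewrite (cbrEw s1 sv) (cbrEw s2 sv) (cbrEw s3 sv) scaler_sumr -big_split /=.
apply: eq_bigr => r _; rewrite scaler_sumr -big_split /=.
apply: eq_bigr => s _; rewrite ccoefP br_l.
exact: cmonom_linear.
Qed.

Lemma cbr_r u : linear (@cbr K S l br u).
Proof.
move=> a v v'; have [d [s1 s2 s3]] := msupp_cover a v v'.
have su : {subset msupp u <= msupp u} by [].
rewrite (cbrEw su s1) (cbrEw su s2) (cbrEw su s3) scaler_sumr -big_split /=.
apply: eq_bigr => r _; rewrite scaler_sumr -big_split /=.
apply: eq_bigr => s _; rewrite ccoefP br_r.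
exact: cmonom_linear.
Qed.

Lemma cbrM x y r s :
  cbr br (<< x *g r >> : current S l) << y *g s >> = << br x y *g r + s >>.
Proof. exact: cbrU. Qed.

End Bracket.

Context (I : choiceType) (e : I -> l) (co : {linear l -> {malg K[I]}}).
Context (coe : forall i, co (e i) = << i >>) (lin_co : forall v : l, lin e (co v) = v).
Local Notation X := (I * S)%type.

Definition cbasis (x : X) : current S l := << e x.1 *g x.2 >>.

Definition ccoord u : {malg K[X]} :=
  \sum_(r <- msupp u) lin (fun i => << (i, r) >>) (co u@_r).

Lemma ccoordE u i r : (ccoord u)@_(i, r) = (co u@_r)@_i.
Proof.
have h s : (lin (fun i => << (i, s) >>) (co u@_s))@_(i, r) = (co u@_s)@_i *+ (s == r).
  rewrite [co _ in RHS]monalgE /lin !raddf_sum -sumrMnl; apply: eq_bigr => j _ /=.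
  rewrite mcoeffZ !mcoeffU xpair_eqE.
  by case: (j == i); case: (s == r); rewrite ?mulr1n ?mulr0n ?mulr1 ?mulr0.
rewrite /ccoord raddf_sum /= (eq_bigr _ (fun s _ => h s)).
have [ru|nru] := boolP (r \in msupp u).
  rewrite (big_fsetD1 r) //= eqxx big1_fset ?addr0 // => s.
  by rewrite !inE => /andP[/negPf -> _] _.
rewrite (mcoeff_outdom nru) linear0 mcoeff0 big1_fset // => s su _.
by case: eqVneq => // sr; rewrite sr (negPf nru) in su.
Qed.

Lemma ccoord_linear : linear ccoord.
Proof.
move=> a u v; apply/malgP => -[i r].
by rewrite mcoeffD mcoeffZ !ccoordE ccoefP linearP mcoeffD mcoeffZ.
Qed.

HB.instance Definition _ :=
  GRing.isLinear.Build K (current S l) {malg K[X]} _ ccoord ccoord_linear.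

Lemma ccoord_basis x : ccoord (cbasis x) = << x >>.
Proof.
case: x => i r; apply/malgP => -[j s]; rewrite ccoordE !mcoeffU xpair_eqE /=.
by case: (r == s); rewrite ?mulr0n ?linear0 ?mcoeff0 ?andbF // mulr1n coe mcoeffU andbT.
Qed.

Lemma lin_ccoord u : lin cbasis (ccoord u) = u.
Proof.
rewrite [RHS]monalgE linear_sum; apply: eq_bigr => r _.
rewrite lin_comp -[in RHS](lin_co u@_r) (linear_lin e _ (cmonom_linear r)).
by apply: eq_lin => i _ /=; rewrite linX.
Qed.

End CurrentLinear.

(** * Orders on letters and exponents *)

Record linear_order (T : eqType) (R : rel T) : Prop := LinearOrder {
  lo_refl : reflexive R;
  lo_anti : antisymmetric R;
  lo_trans : transitive R;
  lo_total : total R }.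

(** The index type of the basis is arbitrary, so an order is taken from the well-ordering
    principle. *)
Lemma linear_order_exists (T : eqType) : exists R : rel T, linear_order R.
Proof.
have [R wo] := wochoice.well_ordering_principle T; exists R.
have woT : wochoice.wo_chain R (predT : {pred T}) by move=> A _; apply: wo.
have tot : total R by move=> x y; apply: (wochoice.wo_chainW woT).
have anti : antisymmetric R.
  by move=> x y; apply: (wochoice.wo_chain_antisymmetric woT).
split=> // [x|y x z xy yz]; first by have := tot x x; rewrite orbb.
(* Transitivity from the least of x, y, z: if it is y or z, antisymmetry identifies it with its
   predecessor in the chain. *)
have [|m [[mA mlb] _]] := wo (mem [:: x; y; z]); first by exists x; apply: mem_head.
have lb t : t \in [:: x; y; z] -> R m t by apply: mlb.
have mA' : m \in [:: x; y; z] := mA.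
move: mA'; rewrite !inE => /or3P[] /eqP em; subst m.
- by apply: lb; rewrite !inE eqxx !orbT.
- have /anti -> // : R x y && R y x by rewrite xy lb // !inE eqxx.
- by have /anti <- // : R y z && R z y by rewrite yz lb // !inE eqxx orbT.
Qed.

(* [eo_shift] supplies letters that are larger than all those that occur in a
   given element of the enveloping algebra. *)
Record exponent_order (S : nmodType) (leS : rel S) : Prop := ExponentOrder {
  eo_order : linear_order leS;
  eo_addI : forall s, injective (fun r : S => r + s);
  eo_shift : forall rs : seq S, exists s, forall r r', r \in rs -> r' \in rs ->
    leS r' (r + s) && (r' != r + s) }.

Lemma nat_exponents : exponent_order (S := nat) leq.
Proof.
split; first by split; [exact: leqnn|exact: anti_leq|exact: leq_trans|exact: leq_total].
  by move=> s r r' /addIn.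
move=> rs; exists (\max_(r <- rs) r).+1 => r r' _ hr'.
have : (r' <= \max_(r <- rs) r)%N by apply: (@leq_bigmax_seq _ _ xpredT id).
set m := (\max_(r <- rs) r)%N => h.
rewrite -[r + _]/(r + m.+1)%N andbC -ltn_neqAle.
by apply: leq_ltn_trans h _; rewrite addnS ltnS leq_addl.
Qed.

Lemma int_exponents : exponent_order (S := int) (<=%R : rel int).
Proof.
split.
- by split; [exact: Order.POrderTheory.lexx|exact: Order.POrderTheory.le_anti
    |exact: Order.POrderTheory.le_trans|exact: Order.TotalTheory.le_total].
- by move=> s; apply: addIr.
(* All exponents lie in [-M, M] for the maximal absolute value M, so adding 2M + 1 carries each of
   them above M. *)
move=> rs; exists (Posz (\max_(r <- rs) `|r|%N).*2.+1) => r r' hr hr'.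
have h t : t \in rs -> (`|t| <= \max_(r <- rs) `|r|)%N.
  by move=> ht; apply: (@leq_bigmax_seq _ _ xpredT (fun t : int => `|t|%N)).
have := h r hr; have := h r' hr'; set m := (\max_(r <- rs) `|r|)%N.
move=> h1 h2; lia.
Qed.

(** Has the shape of [csq]: diagonal terms, then each unordered pair once, without commutativity. *)
Lemma sqr_sum_nat (B : pzRingType) (G : nat -> B) n :
  (\sum_(j < n) G j) ^+ 2 =
  \sum_(j < n) G j ^+ 2 + \sum_(j < n) \sum_(i < j) (G i * G j + G j * G i).
Proof.
elim: n => [|n IH]; first by rewrite !big_ord0 expr0n addr0.
rewrite !big_ord_recr /= expr2 mulrDl !mulrDr -expr2 IH -!expr2.
rewrite big_split /= -mulr_suml -mulr_sumr.
set A := \sum_(j < n) G j ^+ 2; set C := \sum_(j < n) \sum_(i < j) _.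
set s := \sum_(i < n) G i; set x := G n.
by rewrite -!addrA; congr (_ + _); rewrite [RHS]addrC -!addrA.
Qed.

Section CurrentSuperBasis.
Context (K : fieldType) (S : nmodType) (leS : rel S) (ES : exponent_order leS).
Context (l : lmodType K) (br : l -> l -> l) (par : bool -> l -> Prop) (sq : l -> l).
Context (LS : lie_superalgebra par br sq).
Context (I : choiceType) (leI : rel I) (OI : linear_order leI).
Context (e : I -> l) (I0 I1 : {pred I}).
Context (I1E : forall i, (i \in I1) = (i \notin I0)).
Context (b0 : basis_on e I0 (par false)) (b1 : basis_on e I1 (par true)).
Context (co : {linear l -> {malg K[I]}}).
Context (coe : forall i, co (e i) = << i >>) (lin_co : forall v, lin e (co v) = v).
Local Notation X := (I * S)%type.
Local Notation E := (@cbasis K S l I e).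
Local Notation cco := (@ccoord K S l I co).
Local Notation cbr := (@cbr K S l br).

Definition cpar_of (x : X) : bool := x.1 \notin I0.
Definition cle (x y : X) : bool :=
  ((x.2 != y.2) && leS x.2 y.2) || ((x.2 == y.2) && leI x.1 y.1).
Definition csq_of (x : X) : current S l := << sq (e x.1) *g x.2 + x.2 >>.

Lemma cle_order : linear_order cle.
Proof.
have [leSr leSa leSt leSn] := eo_order ES; have [leIr leIa leIt leIn] := OI.
split.
- by move=> [i r]; rewrite /cle /= !eqxx leIr.
- move=> [i r] [j s]; rewrite /cle /= [s == r]eq_sym.
  case: eqVneq => [->|nrs] /=; first by move/leIa ->.
  by rewrite !orbF => /leSa rs; rewrite rs eqxx in nrs.
- move=> [j s] [i r] [k t]; rewrite /cle /=.
  case: (eqVneq r s) => [<-|nrs] /=; first by case: eqVneq => //= _; apply: leIt.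
  rewrite orbF; case: (eqVneq s t) => [<-|nst] /=; first by rewrite (negPf nrs) /= orbF.
  rewrite orbF => rs st; have rt := leSt _ _ _ rs st.
  case: (eqVneq r t) => [ert|_] /=; last by rewrite rt.
  subst t; have ers : r = s by apply: leSa; rewrite rs.
  by rewrite ers eqxx in nrs.
move=> [i r] [j s]; rewrite /cle /= [s == r]eq_sym.
by case: eqVneq => //= _; rewrite !orbF.
Qed.

Let gr := lie_super_grading LS.
Let brl y : linear (br^~ y). Proof. by move=> a u v; apply: (lie_super_linear_l LS). Qed.
Let brr x : linear (br x). Proof. by move=> a u v; apply: (lie_super_linear_r LS). Qed.
Let cbrE x y r s := @cbrM K S l br brl brr x y r s.

Lemma par_basis i : par (i \notin I0) (e i).
Proof.
case: (boolP (i \in I0)) => [|] hi; first by case: b0 => h _ _; apply: h.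
by case: b1 => h _ _; apply: h; rewrite I1E.
Qed.

Lemma par_supp q v : par q v <-> (forall i, (co v)@_i != 0 -> (i \notin I0) = q).
Proof.
split=> [|h].
  case: q => hv i nz.
    by rewrite -I1E; apply: (basis_on_supp coe b1 hv nz).
  by apply/negbTE; rewrite negbK; apply: (basis_on_supp coe b0 hv nz).
rewrite -(lin_co v) /lin big_seq; elim/big_rec: _ => [|i x hi hx].
  exact: (gr_zero gr).
apply: (gr_linear gr) => //; rewrite -(h i) ?mcoeff_neq0 //; exact: par_basis.
Qed.

Lemma cpar_homog q u : cpar par q u <-> homog cpar_of cco q u.
Proof.
split=> [h [i r]|h r]; first by rewrite ccoordE; apply: (par_supp q _).1.
by apply/par_supp => i nz; have := h (i, r); rewrite ccoordE; apply.
Qed.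

Lemma cpar_monom q v r : par q v -> cpar par q (<< v *g r >> : current S l).
Proof.
move=> hv s; rewrite mcoeffU; case: (r == s) => //.
by rewrite mulr0n; apply: (gr_zero gr).
Qed.

Lemma sq0 : sq 0 = 0.
Proof. by rewrite -(scale0r (0 : l)) (sq_scale LS) ?expr0n ?scale0r //;
  apply: (gr_zero gr). Qed.

Lemma current_super_basis : super_basis cle cpar_of E cco cbr csq_of.
Proof.
have [cler clea clet cletot] := cle_order.
have hE i r : E (i, r) = << e i *g r >> by [].
have cN r v : << - v *g r >> = - (<< v *g r >> : current S l) by exact: monalgUN.
have cZ r a v : << a *: v *g r >> = a *: (<< v *g r >> : current S l).
  by exact: (scalable_linear (cmonom_linear r)).
split=> //.
- exact: ccoord_basis.
- exact: lin_ccoord.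
- exact: cbr_l.
- exact: cbr_r.
- move=> [i r] [j s]; apply/cpar_homog; rewrite cbrE; apply: cpar_monom.
  by apply: (lie_super_par LS); apply: par_basis.
- move=> [i r] [j s]; rewrite !cbrE /= (lie_super_anti LS (par_basis i) (par_basis j)).
  by rewrite cN cZ addrC.
- by move=> [i r] /negbNE hi; rewrite cbrE (lie_super_alt LS) ?monalgU0 //;
  case: b0 => h _ _; apply: h.
- move=> [i r] [j s] [k t]; rewrite !cbrE /=.
  rewrite (lie_super_jacobi LS _ (par_basis i) (par_basis j)) monalgUD cZ.
  by rewrite addrA (addrCA s r t) addrA.
- move=> [i r] pi; rewrite !cbrE /= (lie_super_odd LS) ?monalgU0 //.
  by have := par_basis i; rewrite (pi : i \notin I0).
- move=> [i r] pi; apply/cpar_homog; apply: cpar_monom; apply: (sq_par LS).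
  by have := par_basis i; rewrite (pi : i \notin I0).
- move=> [i r] pi; rewrite cbrE /csq_of /= -monalgUD; congr (<< _ *g _ >>).
  have py : par true (e i) by have := par_basis i; rewrite (pi : i \notin I0).
  (* Comparing sq(2y) = 4 sq(y) with the additivity formula gives [y, y] = 2 sq(y) without dividing
     by 2. *)
  have := sq_add LS py py; rewrite -mulr2n -scaler_nat (sq_scale LS) // => h2.
  apply: (addrI (sq (e i) + sq (e i))); rewrite -h2.
  by rewrite -!mulr2n -mulrnA -scaler_nat -natrX.
move=> [i r] [j s] pi; rewrite /csq_of !cbrE /= (sq_ad LS) ?addrA //.
by have := par_basis i; rewrite (pi : i \notin I0).
Qed.

Lemma csq_basis x : cpar_of x -> csq br sq (E x) = csq_of x.
Proof. by move=> _; apply: csqU sq0. Qed.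

(** Both sides are quadratic in y with the same polarization. Agreement is extended from basis
    letters to v (x) x^r, then to sums over exponents by [sqr_sum_nat]. *)
Lemma csq_rep (B : algType K) (f : current S l -> B) : linear f ->
  (forall x y, cpar par true x -> cpar par true y ->
     f (cbr x y) = f x * f y + f y * f x) ->
  (forall x, cpar_of x -> f (csq_of x) = f (E x) ^+ 2) ->
  forall y, cpar par true y -> f (csq br sq y) = f y ^+ 2.
Proof.
move=> lf fbr fsq y py.
have fD u v : f (u + v) = f u + f v by have := lf 1 u v; rewrite !scale1r.
have f0 : f 0 = 0 by apply: (addrI (f 0)); rewrite -fD !addr0.
have fsum (J : Type) (s : seq J) (F : J -> current S l) :
    f (\sum_(j <- s) F j) = \sum_(j <- s) f (F j).
  by elim: s => [|j s IH]; rewrite ?big_nil ?big_cons // fD IH.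
have monom v r : par true v -> f << sq v *g r + r >> = f << v *g r >> ^+ 2.
  move=> pv; suff : par true v /\ f << sq v *g r + r >> = f << v *g r >> ^+ 2 by case.
  have := (par_supp true v).1 pv; rewrite -[in X in _ -> X](lin_co v) /lin => hv.
  rewrite big_seq; elim/big_rec: _ => [|i x hi [px IH]].
    by split; [exact: (gr_zero gr)|rewrite sq0 !monalgU0 f0 expr0n].
  have pi : i \notin I0 by apply: hv; rewrite mcoeff_neq0.
  have pei : par true (e i) by have := par_basis i; rewrite (pi : i \notin I0).
  split; first exact: (gr_linear gr).
  have pe' : par true ((co v)@_i *: e i).
    by rewrite -[_ *: _]addr0; apply: (gr_linear gr) => //; apply: (gr_zero gr).
  set a := (co v)@_i in pe' *.
  have mon (t : S) : linear (fun x : l => f << x *g t >>).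
    by move=> c u w; rewrite cmonom_linear lf.
  rewrite (sq_add LS pe' px) (sq_scale LS _ pei) !monalgUD !fD IH.
  have -> : (<< br (a *: e i) x *g r + r >> : current S l)
      = cbr << a *: e i *g r >> << x *g r >> by rewrite cbrE.
  rewrite fbr; try exact: cpar_monom.
  rewrite (scalable_linear (mon _)) /= (fsq (i, r) pi).
  rewrite (scalable_linear (mon _)) /= -exprZn -[f (E (i, r))]/(f << e i *g r >>).
  by rewrite !expr2 !mulrDl !mulrDr -!addrA; congr (_ + _); rewrite addrC -!addrA.
rewrite /csq fD; set s := enum_fset (msupp y).
have ey : y = \sum_(r <- s) << y@_r *g r >> by exact: monalgE.
have fy : f y = \sum_(j < size s) f << y@_(s`_j) *g s`_j >>.
  by rewrite {1}ey fsum (big_nth 0) big_mkord.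
rewrite fy (sqr_sum_nat (fun j =>
  f << y@_(s`_j) *g s`_j >>)) fsum (big_nth 0) big_mkord; congr (_ + _).
  by apply: eq_bigr => j _; apply: monom.
rewrite fsum; apply: eq_bigr => j _; rewrite fsum; apply: eq_bigr => i _.
by rewrite -cbrE fbr //; apply: cpar_monom.
Qed.

End CurrentSuperBasis.

(** * Iterated commutators in characteristic p *)

Lemma iter_commutator (R : pzRingType) (a t : R) n :
  iter n (fun u => a * u - u * a) t =
  \sum_(i < n.+1) (-1) ^+ i * (a ^+ (n - i) * t * a ^+ i) *+ 'C(n, i).
Proof.
elim: n => [|n IH]; first by rewrite big_ord1 /= !expr0 !mul1r mulr1.
pose T m i := (-1) ^+ i * (a ^+ (m - i) * t * a ^+ i).
have Tl i : (i < n)%N -> a * T n i.+1 = T n.+1 i.+1.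
  move=> lt; rewrite /T mulrA (commr_sign a i.+1) -mulrA; congr (_ * _).
  by rewrite subSS -(subnSK lt) (exprS a (n - i.+1)) !mulrA.
have Tr i : (i <= n)%N -> T n i * a = - T n.+1 i.+1.
  by move=> le; rewrite /T exprS mulN1r mulNr opprK subSS exprSr !mulrA.
rewrite iterS IH mulr_sumr mulr_suml.
rewrite [X in X - _](_ : _ = T n.+1 0 + \sum_(i < n) T n.+1 i.+1 *+ 'C(n, i.+1));
  last first.
  rewrite big_ord_recl; congr (_ + _).
    by rewrite /T !subn0 !expr0 !mul1r !mulr1 bin0 mulr1n mulrA exprS.
  by apply: eq_bigr => i _; rewrite mulrnAr Tl.
rewrite [X in _ - X](_ : _ = - (\sum_(i < n) T n.+1 i.+1 *+ 'C(n, i)) - T n.+1 n.+1);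
  last first.
  rewrite big_ord_recr /= -sumrN; congr (_ + _); last by rewrite binn mulr1n Tr.
  by apply: eq_bigr => i _; rewrite mulrnAl (Tr i) ?mulNrn // ltnW.
rewrite [RHS]big_ord_recl big_ord_recr /= bin0 mulr1n binn mulr1n -/(T _ _) -/(T _ _).
rewrite opprD !opprK -addrA; congr (_ + _); rewrite addrA; congr (_ + _).
rewrite -big_split /=; apply: eq_bigr => i _.
by rewrite -mulrnDr binS.
Qed.

(** The binomial coefficients C(p, i) with 0 < i < p vanish. Together with [pmap_ad] this makes y^p
    - y^[p] central. *)
Lemma iter_commutator_pchar (R : nzRingType) (p : nat) (a t : R) : p \in [pchar R] ->
  iter p (fun u => a * u - u * a) t = a ^+ p * t - t * a ^+ p.
Proof.
move=> hp; have p_pr := pcharf_prime hp.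
rewrite iter_commutator; case: p hp p_pr => // p hp p_pr.
rewrite big_ord_recl big_ord_recr /= subn0 expr0 mul1r mulr1 bin0 mulr1n.
rewrite big1 ?add0r => [|i _]; last first.
  have : (p.+1 %| 'C(p.+1, i.+1))%N by rewrite prime_dvd_bin //= ltnS ltn_ord.
  by case/dvdnP => m ->; rewrite mulrnA (mulrn_pchar hp).
rewrite /bump /= add1n subnn expr0 mul1r binn mulr1n; congr (_ + _).
(* Frobenius covers p = 2 as well, where 1 = -1. *)
have -> : (-1) ^+ p.+1 = -1 :> R.
  by rewrite -(pFrobenius_autE hp) pFrobenius_autN pFrobenius_aut1.
by rewrite mulN1r.
Qed.

Lemma splits_count (X : choiceType) (x : X) (w : seq X) :
  count (fun s => s.1.2 == x) (splits w) = count_mem x w.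
Proof. by elim: w => //= y w IH; rewrite count_map -IH. Qed.

(** * The center *)

Section CurrentCenter.
Context (K : fieldType) (p : nat) (hp : p \in [pchar K]).
Context (S : nmodType) (leS : rel S) (ES : exponent_order leS).
Context (l : lmodType K) (br : l -> l -> l) (par : bool -> l -> Prop) (sq : l -> l).
Context (LS : lie_superalgebra par br sq).
Context (I : choiceType) (leI : rel I) (OI : linear_order leI).
Context (e : I -> l) (I0 I1 J : {pred I}).
Context (I1E : forall i, (i \in I1) = (i \notin I0)).
Context (b0 : basis_on e I0 (par false)) (b1 : basis_on e I1 (par true)).
Context (hJ : basis_on e J (lie_center br)) (JI0 : {subset J <= I0}).
Context (co : {linear l -> {malg K[I]}}).
Context (coe : forall i, co (e i) = << i >>) (lin_co : forall v, lin e (co v) = v).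
Local Notation X := (I * S)%type.
Local Notation g := (current S l).
Local Notation E := (@cbasis K S l I e).
Local Notation cco := (@ccoord K S l I co).
Local Notation cbr := (@cbr K S l br).
Local Notation cpar := (@cpar K S l par).
Local Notation pX := (@cpar_of S I I0).
Local Notation leX := (cle leS leI).
Context (pg : g -> g) (hpg : restricted cbr p (cpar false) pg).
Context (U : algType K) (iota : g -> U).
Context (HU : enveloping_superalgebra cpar cbr (@csq K S l br sq) iota).
Local Notation N := (normal_word leX pX).
Local Notation word := (basis_word E iota).
Local Notation wpar := (wpar pX).
Local Notation homog := (homog pX cco).
Context (c : {linear U -> {malg K[N]}}).
Context (c_word : forall n : N, c (word (val n)) = << n >>).
Context (c_lin : forall u, lin (fun n : N => word (val n)) (c u) = u).
Context (c_supp : forall w (n : N), (c (word w))@_n != 0 ->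
        (size (val n) <= size w)%N /\ wpar (val n) = wpar w).
Local Notation Flt := (Flt c).

Let SB : super_basis leX pX E cco cbr (@csq_of K S l sq I e) :=
  current_super_basis ES LS OI I1E b0 b1 coe lin_co.
Let homogP q u : cpar q u <-> homog q u := cpar_homog LS I1E b0 b1 coe lin_co q u.

Let iota_linear : linear iota. Proof. by have [[]] := HU. Qed.
Let iota_comm a b x y : homog a x -> homog b y ->
  iota x * iota y = koszul a b *: (iota y * iota x) + iota (cbr x y).
Proof.
have [[_ h _] _] := HU; move=> /homogP hx /homogP hy; rewrite (h _ _ _ _ hx hy) koszulM.
by rewrite addrCA subrr addr0.
Qed.

Let brl y : linear (br^~ y). Proof. by move=> a u v; apply: (lie_super_linear_l LS). Qed.
Let brr x : linear (br x). Proof. by move=> a u v; apply: (lie_super_linear_r LS). Qed.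

Let homE x : homog (pX x) (E x). Proof. exact: (basis_homog SB). Qed.

(** The inductive [env_par] does not show that even and odd part meet in 0; on coordinates this is
    immediate. The two notions agree by [env_parP] and [par_env]. *)
Record parP (a : bool) (u : U) : Prop := ParP {
  parPE : forall n : N, (c u)@_n != 0 -> wpar (val n) = a }.

Lemma parP_linear a k u v : parP a u -> parP a v -> parP a (k *: u + v).
Proof.
move=> [hu] [hv]; split=> n; rewrite ucoefP.
have [/hv //|] := boolP ((c v)@_n != 0); rewrite negbK => /eqP ->; rewrite addr0.
by have [/hu //|] := boolP ((c u)@_n != 0); rewrite negbK => /eqP ->; rewrite mulr0 eqxx.
Qed.

Lemma parP0 a : parP a 0.
Proof. by split=> n; rewrite linear0 mcoeff0 eqxx. Qed.

Lemma parP_word w : parP (wpar w) (word w).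
Proof. by split=> n /c_supp[]. Qed.

Lemma parP_ind a (P : U -> Prop) : P 0 ->
  (forall k u v, P u -> P v -> P (k *: u + v)) ->
  (forall w, wpar w = a -> P (word w)) -> forall u, parP a u -> P u.
Proof.
move=> P0 PD Pw u [hu]; rewrite -(c_lin u) /lin big_seq.
elim/big_rec: _ => // n x hn Px; apply: PD => //; apply: Pw.
by apply: hu; rewrite mcoeff_neq0.
Qed.

Lemma parP_mul a b u v : parP a u -> parP b v -> parP (a (+) b) (u * v).
Proof.
move=> hu hv; move: u hu; apply: parP_ind => [|k u u' hu hu'|w <-].
- by rewrite mul0r; apply: parP0.
- by rewrite mulrDl -scalerAl; apply: parP_linear.
move: v hv; apply: parP_ind => [|k u u' hu hu'|w' <-].
- by rewrite mulr0; apply: parP0.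
- by rewrite mulrDr -scalerAr; apply: parP_linear.
by rewrite -word_cat -wpar_cat; apply: parP_word.
Qed.

Lemma parP_iota a x : cpar a x -> parP a (iota x).
Proof.
move=> /homogP hx; rewrite (iota_lin (sb_lin SB) iota_linear) /lin big_seq.
elim/big_rec: _ => [|y u hy hu]; first exact: parP0.
apply: parP_linear => //; rewrite -(hx y) ?mcoeff_neq0 //.
have := parP_word [:: y]; rewrite word1 /= addbF; exact.
Qed.

Lemma env_parP a u : env_par iota cpar a u -> parP a u.
Proof.
elim=> {a u} [a x hx|a||a k u v _ hu _ hv|a b u v _ hu _ hv].
- exact: parP_iota.
- exact: parP0.
- by have := parP_word [::]; rewrite word_nil.
- exact: parP_linear.
- exact: parP_mul.
Qed.

Lemma env_word w : env_par iota cpar (wpar w) (word w).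
Proof.
elim: w => [|x w IH]; first by rewrite word_nil; apply: EnvParOne.
rewrite word_cons wpar_cons; apply: EnvParMul => //; apply: EnvParGen.
by apply/homogP; apply: (basis_homog SB).
Qed.

Lemma par_env a u : parP a u -> env_par iota cpar a u.
Proof.
by apply: parP_ind => [|k u' v|w <-];
  [apply: EnvParZero | apply: EnvParLinear | apply: env_word].
Qed.

Lemma parP_disjoint a u v : parP a u -> parP (~~ a) v -> u + v = 0 -> u = 0.
Proof.
move=> [hu] [hv] uv; have vu : v = - u by apply/eqP; rewrite -addr_eq0 addrC uv.
rewrite -(c_lin u) /lin big1_seq // => n /andP[_].
rewrite -mcoeff_neq0 => nz; have := hv n; rewrite vu linearN mcoeffN oppr_eq0 => /(_ nz).
by rewrite (hu n nz); case: a {hu hv}.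
Qed.

Definition supercentral q (z : U) :=
  forall x, z * iota (E x) = koszul q (pX x) *: (iota (E x) * z).

(** Testing against a single letter makes one of u0, u1 zero; the two remaining supercommutators
    have opposite parity, so each vanishes. *)
Lemma super_center_homog z : super_center iota cpar z -> exists z0 z1,
  [/\ z = z0 + z1, parP false z0, parP true z1,
    supercentral false z0 & supercentral true z1].
Proof.
move=> [z0 [z1 [h0 h1 -> hz]]]; have p0 := env_parP h0; have p1 := env_parP h1.
suff h x : z0 * iota (E x) - koszul false (pX x) *: (iota (E x) * z0) = 0 /\
    z1 * iota (E x) - koszul true (pX x) *: (iota (E x) * z1) = 0.
  by exists z0, z1; split=> // x; apply/eqP; rewrite -subr_eq0;
    have [/eqP a /eqP b] := h x.
have px : parP (pX x) (iota (E x)).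
  by apply: parP_iota; apply/homogP; apply: (basis_homog SB).
have ex : env_par iota cpar (pX x) (iota (E x)) by apply: par_env.
set A := z0 * _ - _; set B := z1 * _ - _.
have AB : A + B = 0.
  case E1 : (pX x) in ex *.
    have := hz 0 _ (EnvParZero _ _ _) ex;
      rewrite /scomm !mulr0 !mul0r mulr0 !subr0 addr0 add0r.
    by rewrite !koszulM /A /B E1.
  have := hz _ 0 ex (EnvParZero _ _ _); rewrite /scomm !mulr0 !mul0r mulr0 !subr0 !addr0.
  by rewrite !koszulM /A /B E1 scaler0 subrr addr0.
have pA : parP (pX x) A.
  rewrite /A addrC -scaleNr; apply: parP_linear; last by have := parP_mul p0 px.
  by have := parP_mul px p0; rewrite addbF.
have pB : parP (~~ pX x) B.
  rewrite /B addrC -scaleNr; apply: parP_linear; last by have := parP_mul p1 px;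
    rewrite addTb.
  by have := parP_mul px p1; rewrite addbT.
have A0 := parP_disjoint pA pB AB; split=> //.
by move: AB; rewrite A0 add0r.
Qed.

(** For a word m and the exponent r0, the signed coefficients of the words obtained by inserting
    some (j, r0) into m are collected in one vector v(m) of l. It is central, so its coordinate at i
    outside [J] is 0. If m is n with one x deleted, this coordinate is the coefficient of n times
    the signed number of x in n. *)
Lemma supercentral_top z q d (n : N) : parP q z -> supercentral q z ->
  Flt d.+1 z -> (c z)@_n != 0 -> size (val n) = d ->
  forall x, x \in val n -> x.1 \notin J ->
    ~~ pX x /\ (p %| count_mem x (val n))%N.
Proof.
move=> [zpar] zc hz nz szn [i r0] xn iJ.
pose exps := flatten [seq [seq x.2 | x <- val m] | m : N <- enum_fset (msupp (c z))].
have [s shift] := eo_shift ES exps.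
have expsP (m : N) x : (c z)@_m != 0 -> x \in val m -> x.2 \in exps.
  rewrite mcoeff_neq0 => hm hx; apply/flattenP; exists [seq x.2 | x <- val m].
    by apply/mapP; exists m.
  by apply/mapP; exists x.
have coE x b y : (cco (cbr (E x) (E (b, s))))@_y =
    (co (br (e x.1) (e b)))@_y.1 *+ (x.2 + s == y.2).
  case: x y => [j r] [j' r']; rewrite (cbrM brl brr) ccoordE mcoeffU.
  by rewrite linearMn /= mcoeffMn.
have ident b := top_identity SB iota_linear iota_comm c_word c_lin c_supp hz zpar (zc
  (b, s)).
have {}ident b m y : \sum_(n <- msupp (c z))
    \sum_(t <- splits (val n) | (size (val n) == d) && (t.1.1 ++ t.2 == m))
      (c z)@_n * (koszul (pX t.1.2) (wpar t.2) * (cco (cbr (E t.1.2) (E (b, s))))@_y) = 0.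
  apply: ident => k k' x a y' hk hk' xk ak'; rewrite coE.
  have [ey _|_] := eqVneq (x.2 + s) y'.2; last by rewrite mulr0n eqxx.
  have /andP[le_a ne_a] := shift _ _ (expsP _ _ hk xk) (expsP _ _ hk' ak').
  rewrite /good /cle -ey le_a ne_a /= [a == y'](_ : _ = false) //.
  by apply/negbTE; apply: contraNneq ne_a => ->; rewrite ey.
pose v m := \sum_(n <- msupp (c z))
    \sum_(t <- splits (val n) | [&& size (val n) == d, t.1.1 ++ t.2 == m & t.1.2.2 == r0])
      ((c z)@_n * koszul (pX t.1.2) (wpar t.2)) *: e t.1.2.1.
have v_coef (f : l -> K^o) m : linear f -> f (v m) = \sum_(n <- msupp (c z))
    \sum_(t <- splits (val n) | [&& size (val n) == d, t.1.1 ++ t.2 == m & t.1.2.2 == r0])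
      (c z)@_n * koszul (pX t.1.2) (wpar t.2) * f (e t.1.2.1).
  move=> lf; pose f' : {linear l -> K^o} :=
    HB.pack f (GRing.isLinear.Build K l K^o _ f lf).
  rewrite -[f]/(f' : l -> K^o) linear_sum; apply: eq_bigr => k _.
  by rewrite linear_sum; apply: eq_bigr => t _; rewrite linearZ.
have v_central m : lie_center br (v m).
  have h b : br (v m) (e b) = 0.
    rewrite -(lin_co (br (v m) (e b))) (_ : co _ = 0) ?linear0 //; apply/malgP => i'.
    have lF : linear (fun w => (co (br w (e b)))@_i' : K^o).
      by move=> a w w'; rewrite brl linearP mcoeffD mcoeffZ.
    rewrite mcoeff0 (v_coef _ m lF) -[RHS](ident b m (i', r0 + s)).
    apply: eq_bigr => k _; rewrite big_mkcond [RHS]big_mkcond; apply: eq_bigr => t _.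
    (* Adding s is injective, so the exponent r0 + s of the new letter singles out the deleted
       letters of exponent r0. *)
    rewrite coE /= (inj_eq (@eo_addI _ _ ES s)).
    case: (size _ == d) => //=; case: (_ == m) => //=.
    by case: (_ == r0); rewrite ?mulr1n ?mulr0n ?mulr0 // mulrA.
  move=> w; rewrite -(lin_co w) (linear_lin _ _ (brr _)).
  by rewrite -[RHS](lin0 _ (co w)); apply: eq_lin => b _ /=.
have v_zero m : (co (v m))@_i = 0.
  apply/eqP; apply: contraNT iJ => /=; exact: (basis_on_supp coe hJ (v_central m)).
have [u0 [v0 en]] : exists u0 v0, val n = u0 ++ (i, r0) :: v0.
  by case/splitPr: xn => u0 v0; exists u0, v0.
have lco : linear (fun w => (co w)@_i : K^o).
  by move=> a w w'; rewrite linearP mcoeffD mcoeffZ.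
have := v_zero (u0 ++ v0); rewrite (v_coef _ (u0 ++ v0) lco) => hsum.
pose sgt (t : seq X * X * seq X) : K := koszul (pX (i, r0)) (wpar t.2).
have perm_mid (u w : seq X) x : perm_eq (u ++ x :: w) (x :: u ++ w).
  exact: permEl (perm_catCA u [:: x] w).
have nrm u w x (k : N) : val k = u ++ x :: w -> normal leX pX (u ++ w).
  move=> ek; apply: (subseq_sorted (good_trans (sb_anti SB) (sb_trans SB))) (valP k).
  by rewrite ek cat_subseq // subseq_cons.
have coe_i x : x.2 = r0 -> (co (e x.1))@_i = (x == (i, r0))%:R.
  by case: x => j r /= ->; rewrite coe mcoeffU xpair_eqE eqxx andbT.
have {hsum} hsum : \sum_(t <- splits (val n) | t.1.2 == (i, r0)) sgt t = 0.
  (* Only n contributes: inserting (i, r0) into the same m gives the same letters, and these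
     determine a normal word. *)
  apply: (mulfI nz); rewrite mulr0 -[RHS]hsum.
  rewrite (bigD1_seq n) ?fset_uniq //=; last by rewrite -mcoeff_neq0.
  rewrite [X in _ + X]big1 ?addr0 => [|k nk]; last first.
    rewrite big_seq_cond big1 // => t /andP[tk /and3P[_ /eqP et /eqP er]].
    rewrite coe_i //; case: eqVneq => [tx|_]; last by rewrite mulr0.
    case/eqP: nk; apply: val_inj.
    apply: (normal_uniq_perm (sb_anti SB) (sb_trans SB) (valP k) (valP n)).
    have ek : val k = _ := splitsP tk.
    rewrite ek en tx (permPl (perm_mid _ _ _)) et perm_sym.
    exact: perm_mid.
  rewrite mulr_sumr big_mkcond [RHS]big_mkcond; apply: eq_big_seq => t tn.
  rewrite szn eqxx /=; have [tx|ntx] := eqVneq t.1.2 (i, r0).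
    have -> : t.1.1 ++ t.2 == u0 ++ v0.
      apply/eqP; apply: (normal_uniq_perm (sb_anti SB) (sb_trans SB)).
      - exact: nrm (splitsP tn).
      - exact: nrm en.
      rewrite -(perm_cons (i, r0)) -(permPl (perm_mid _ _ _)) -(permPr (perm_mid _ _ _)).
      have et : val n = _ := splitsP tn.
      by rewrite -en -tx -et.
    have er : t.1.2.2 = r0 by rewrite tx.
    by rewrite (coe_i _ er) er tx !eqxx mulr1.
  case: ifP => // /andP[_ /eqP er]; rewrite coe_i // (negPf ntx) mulr0 //.
(* For an even letter all signs are 1 and the sum is its multiplicity in K. For an odd one normality
   leaves a single occurrence, so the sum is a sign and cannot be 0. *)
have [odd_x|even_x] := boolP (pX (i, r0)); last first.
  split=> //; rewrite (dvdn_pcharf hp) -splits_count -sum1_count natr_sum.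
  apply/eqP; rewrite -[RHS]hsum; apply: eq_bigr => t _.
  by rewrite /sgt /koszul (negPf even_x).
suff : \sum_(t <- splits (val n) | t.1.2 == (i, r0)) sgt t != 0 by rewrite hsum eqxx.
have : size (filter (fun t => t.1.2 == (i, r0)) (splits (val n))) = 1%N.
  rewrite size_filter splits_count; apply/eqP;
    rewrite eqn_leq -has_count has_pred1 xn andbT.
  rewrite leqNgt; apply/negP => two.
  have : sorted (good leX pX) (filter (pred1 (i, r0)) (val n)).
    exact: (sorted_filter (good_trans (sb_anti SB) (sb_trans SB))) (valP n).
  have /all_pred1P -> : all (pred1 (i, r0)) (filter (pred1 (i, r0)) (val n)).
    exact: filter_all.
  rewrite size_filter; case: (count_mem _ _) two => [|[|k]] // _.
  by rewrite /= /good eqxx odd_x andbF.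
rewrite -big_filter; case: (filter _ _) => [|t [|]] // _; rewrite big_seq1 /sgt /koszul.
by rewrite signr_eq0.
Qed.

(** By [supercentral_top] and the evenness of [J], words of top length have only even letters, which
    is impossible in an odd element; so the degree bound drops until nothing is left. *)
Lemma supercentral_odd z : parP true z -> supercentral true z -> z = 0.
Proof.
move=> pz zc; have [d] := Flt_bound c z; elim: d => [|d IH] hz.
  by rewrite -(c_lin z) /lin big1 // => n _; rewrite (FltP hz) ?scale0r.
apply: IH; split=> n; rewrite leq_eqVlt => /predU1P[sn|lt]; last exact: (FltP hz).
apply/eqP; apply: contraT => nz.
have top := supercentral_top pz zc hz nz (esym sn).
have := parPE pz nz; suff -> : wpar (val n) = false by [].
apply: even_par; apply/allP => x xn /=; rewrite /cpar_of negbK.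
have [/JI0 //|nJ] := boolP (x.1 \in J).
by have [] := top x xn nJ; rewrite /cpar_of negbK.
Qed.

Definition weight (x : X) : nat := if x.1 \in J then 1 else p.
Definition generator (x : X) : U :=
  let y : g := << e x.1 *g x.2 >> in
  if x.1 \in J then iota y else iota y ^+ p - iota (pg y).
Definition central_even (z : U) := parP false z /\ forall u, z * u = u * z.

Lemma central_ext z : (forall x, z * iota (E x) = iota (E x) * z) ->
  forall u, z * u = u * z.
Proof.
move=> h u; rewrite -(c_lin u) /lin mulr_sumr mulr_suml; apply: eq_bigr => n _.
rewrite -scalerAr -scalerAl; congr (_ *: _); elim: (val n) => [|x w IH].
  by rewrite word_nil mulr1 mul1r.
by rewrite word_cons mulrA h -mulrA IH mulrA.
Qed.

(** Evenness of y removes all signs, so x need not be homogeneous. *)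
Lemma iota_even_comm y x : cpar false y ->
  iota (cbr y x) = iota y * iota x - iota x * iota y.
Proof.
move=> /homogP hy; rewrite (br_sumr SB y x) (linear_lin _ _ iota_linear).
rewrite (iota_lin (sb_lin SB) iota_linear x) /lin mulr_sumr mulr_suml -sumrB.
apply: eq_bigr => z _ /=; rewrite -scalerAr -scalerAl -scalerBr; congr (_ *: _).
by rewrite (iota_comm hy (@homE z)) /koszul /= expr0 scale1r addrAC subrr add0r.
Qed.

(** [iota] turns ad(y)^p into the p-fold commutator with [iota y], which is the commutator with its
    p-th power, while ad(y)^p = ad(y^[p]) in g. *)
Lemma p_center_commutes y : cpar false y -> forall u,
  (iota y ^+ p - iota (pg y)) * u = u * (iota y ^+ p - iota (pg y)).
Proof.
move=> hy; apply: central_ext => x; apply/eqP.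
have hpU : p \in [pchar U] by rewrite pchar_lalg.
have h : iota (cbr (pg y) (E x)) = iota y ^+ p * iota (E x) - iota (E x) * iota y ^+ p.
  rewrite -(iter_commutator_pchar _ _ hpU) -(pmap_ad hpg _ hy).
  by elim: {1 2}p => //= m <-; rewrite iota_even_comm.
rewrite (iota_even_comm _ (pmap_stable hpg hy)) in h.
by rewrite -subr_eq0 mulrBl mulrBr opprD addrACA -opprD -h subrr.
Qed.

Lemma parP_exp u n : parP false u -> parP false (u ^+ n).
Proof.
move=> hu; elim: n => [|n IH]; last by rewrite exprS; exact: (parP_mul hu IH).
by have := parP_word [::]; rewrite word_nil.
Qed.

Lemma central_even_p_center y : cpar false y ->
  central_even (iota y ^+ p - iota (pg y)).
Proof.
move=> hy; split; last exact: p_center_commutes.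
rewrite addrC -scaleN1r; apply: parP_linear.
  by apply: parP_iota; apply: (pmap_stable hpg).
by apply: parP_exp; apply: parP_iota.
Qed.

Lemma cpar_E i r : i \in I0 -> cpar false (E (i, r)).
Proof.
move=> hi; apply/homogP => y hy.
by rewrite (homE hy) /cpar_of /= hi.
Qed.

Lemma central_even_J i r : i \in J -> central_even (iota << e i *g r >>).
Proof.
move=> iJ; have hE := cpar_E r (JI0 iJ); split; first exact: parP_iota.
apply: central_ext => -[j s]; apply/eqP; rewrite -subr_eq0 -iota_even_comm //.
rewrite (cbrM brl brr); have [h _ _] := hJ; rewrite (h i iJ) monalgU0.
by have := iota_linear (-1) 0 0; rewrite scaler0 addr0 scaleN1r addNr => ->.
Qed.

Lemma central_even_subalg (G : U -> Prop) z :
  (forall u, G u -> central_even u) -> subalg G z -> central_even z.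
Proof.
move=> hG; elim=> {z} [u /hG //||a u v _ [pu cu] _ [pv cv]|u v _ [pu cu] _ [pv cv]].
- split=> [|u]; last by rewrite mulr1 mul1r.
  by have := parP_word [::]; rewrite word_nil.
- split=> [|w]; first exact: parP_linear.
  by rewrite mulrDl mulrDr -scalerAl -scalerAr cu cv.
split=> [|w]; first exact: (parP_mul pu pv).
by rewrite -mulrA cv mulrA cu mulrA.
Qed.

(** The odd component vanishes by [supercentral_odd], and for even elements supercommuting is
    commuting. *)
Lemma super_centerP z : super_center iota cpar z <-> central_even z.
Proof.
split=> [/super_center_homog [z0 [z1 [-> p0 p1 c0 c1]]]|[pz cz]].
  rewrite (supercentral_odd p1 c1) addr0; split=> //; apply: central_ext => x.
  by rewrite c0 /koszul expr0 scale1r.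
exists z, 0; split; rewrite ?addr0 //; first exact: par_env.
  exact: EnvParZero.
move=> u0 u1 _ _; rewrite /scomm /= !expr0 !mul1r !(mul0r, mulr0) !cz !subrr.
by rewrite !addr0.
Qed.

Lemma super_center_even : (forall i, i \in I0) ->
  forall z, super_center iota cpar z <-> center z.
Proof.
move=> hI z; rewrite super_centerP /center; split=> [[_ cz] u|cz].
  by rewrite cz subrr.
split=> [|u]; last by apply/eqP; rewrite -subr_eq0 cz.
split=> n _; apply: even_par; apply/allP => x _ /=.
by rewrite /cpar_of hI.
Qed.

Lemma central_even_generator x : x.1 \in I0 -> central_even (generator x).
Proof.
case: x => i r /= hi; rewrite /generator /=; case: ifP => iJ.
  exact: central_even_J.
by apply: central_even_p_center; apply: cpar_E.
Qed.

(** The correction y^[p] contributes words of length at most one, which is below p. *)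
Lemma generator_top x : Flt (weight x) (generator x - word (nseq (weight x) x)).
Proof.
rewrite /weight /generator /=; case: ifP => _; first by rewrite word1 subrr; apply: Flt0.
have -> : word (nseq p x) = iota << e x.1 *g x.2 >> ^+ p.
  by rewrite /basis_word big_nseq iter_mulr_1.
rewrite addrAC subrr add0r; apply: FltN; apply: Flt_le (Flt_iota SB iota_linear c_supp _).
exact: prime_gt1 (pcharf_prime hp).
Qed.

Theorem current_super_center :
  (forall z, super_center iota cpar z <->
     subalg (fun u =>
       (exists2 jr : X, jr.1 \in J & u = iota << e jr.1 *g jr.2 >>) \/
       p_center p (cpar false) pg iota u) z) /\
  freely_generated (super_center iota cpar) [pred x : X | x.1 \in I0] generator.
Proof.
have wt_gt0 x : (0 < weight x)%N.
  by rewrite /weight; case: ifP => // _; apply: prime_gt0 (pcharf_prime hp).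
have evenD : {in [pred x : X | x.1 \in I0], forall x, ~~ pX x}.
  by move=> x; rewrite inE /cpar_of negbK.
have topD : {in [pred x : X | x.1 \in I0],
    forall x, Flt (weight x) (generator x - word (nseq (weight x) x))}.
  by move=> x _; apply: generator_top.
have genZ z : super_center iota cpar z <->
    subalg (fun u => exists2 t, t \in [pred x : X | x.1 \in I0] & u = generator t) z.
  rewrite super_centerP; split; last first.
    by apply: central_even_subalg => u [x hx ->]; apply: central_even_generator.
  apply: (gen_generate SB iota_linear iota_comm c_word c_lin c_supp evenD topD (Z :=
    central_even)).
  - by move=> a u v [pu cu] [pv cv]; split=> [|w];
    [exact: parP_linear|rewrite mulrDl mulrDr -scalerAl -scalerAr cu cv].
  - move=> s /allP hs; apply: (@central_even_subalg (fun u =>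
    exists2 t, t \in [pred x : X | x.1 \in I0] & u = generator t)).
      by move=> u [x hx ->]; apply: central_even_generator.
    elim: s hs => [|x s IH] hs; first by rewrite big_nil; apply: SubalgOne.
    rewrite big_cons; apply: SubalgMul.
      by apply: SubalgGen; exists x => //; apply: hs; rewrite mem_head.
    by apply: IH => y hy; apply: hs; rewrite inE hy orbT.
  move=> u d n [pu cu] hu szn nz.
  have cu' : supercentral false u by move=> x; rewrite cu /koszul expr0 scale1r.
  have top := supercentral_top pu cu' hu nz szn.
  split=> [|x xn]; first (apply/allP => x xn /=; rewrite inE).
    have [/JI0 //|nJ] := boolP (x.1 \in J).
    by have [] := top x xn nJ; rewrite /cpar_of negbK.
  rewrite /weight; case: ifP => [_|/negbT nJ]; first exact: dvd1n.
  by have [] := top x xn nJ.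
split=> [z|]; last split.
- rewrite genZ; split.
    elim=> {z} [u [[i r] hi ->]||*|*];
      [|exact: SubalgOne|exact: SubalgLinear|exact: SubalgMul].
    apply: SubalgGen; rewrite /generator /=; case: ifP => iJ; [left;
      by exists (i, r)|right].
    by apply: SubalgGen; exists << e i *g r >> => //; apply: cpar_E.
  move=> h; apply/genZ/super_centerP;
    apply: central_even_subalg h => u [[[i r] /= iJ ->]|].
    exact: central_even_J.
  by apply: central_even_subalg => v [y hy ->]; apply: central_even_p_center.
- by move=> x y hx hy; have [_ ->] := central_even_generator hx.
- exact: genZ.
exact: (gen_alg_independent SB iota_linear iota_comm c_word c_lin c_supp evenD wt_gt0
  topD).
Qed.

End CurrentCenter.

Lemma expo_exponent_order k : exists leS : rel (expo k), exponent_order leS.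
Proof.
by case: k; [exists leq; apply: nat_exponents | exists <=%R; apply: int_exponents].
Qed.

(** The order on letters and the coordinates are auxiliary and disappear from the statement. The
    last conclusion serves Lie algebras, where every letter is even. *)
Theorem super_center_current (K : fieldType) (p : nat) (hp : p \in [pchar K])
    (k : expo_kind) (l : lmodType K) (br : l -> l -> l)
    (par : bool -> l -> Prop) (sq : l -> l) (I : choiceType) (e : I -> l)
    (J I0 I1 : {pred I})
    (pg : current (expo k) l -> current (expo k) l)
    (U : algType K) (iota : current (expo k) l -> U) :
  basis_on e predT (fun _ => True) -> basis_on e J (lie_center br) ->
  lie_superalgebra par br sq ->
  (forall i, (i \in I1) = (i \notin I0)) ->
  basis_on e I0 (par false) -> basis_on e I1 (par true) -> {subset J <= I0} ->
  restricted (@cbr K (expo k) l br) p (@cpar K (expo k) l par false) pg ->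
  enveloping_superalgebra (@cpar K (expo k) l par) (@cbr K (expo k) l br)
    (@csq K (expo k) l br sq) iota ->
  [/\ forall z, super_center iota (@cpar K (expo k) l par) z <->
        subalg (fun u =>
          (exists2 jr : I * expo k, jr.1 \in J & u = iota << e jr.1 *g jr.2 >>) \/
          p_center p (@cpar K (expo k) l par false) pg iota u) z,
      freely_generated (super_center iota (@cpar K (expo k) l par))
        [pred ir : I * expo k | ir.1 \in I0]
        (fun ir => let y : current (expo k) l := << e ir.1 *g ir.2 >> in
          if ir.1 \in J then iota y else iota y ^+ p - iota (pg y))
    & (forall i, i \in I0) ->
        forall z, super_center iota (@cpar K (expo k) l par) z <-> center z].
Proof.
move=> he hJ LS I1E b0 b1 JI0 hpg HU.
have [leS ES] := expo_exponent_order k.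
have [leI OI] := linear_order_exists I.
have [co [coe lin_co]] := coordinates_exist he.
have SB := current_super_basis ES LS OI I1E b0 b1 coe lin_co.
have [c [c_word c_lin c_supp]] := pbw SB (cpar_homog LS I1E b0 b1 coe lin_co)
  (@csq_basis _ _ _ _ _ _ LS _ e I0) (csq_rep LS I1E b0 b1 coe lin_co) HU.
have [h1 h2] := current_super_center hp ES LS OI I1E b0 b1 hJ JI0 coe lin_co hpg HU
  c_word c_lin c_supp.
split=> // hI0; exact: (super_center_even hp ES LS OI I1E b0 b1 hJ JI0 coe lin_co HU
  c_word c_lin c_supp hI0).
Qed.

(** * Lie algebras as Lie superalgebras *)

Section TrivialGrading.
Context (K : fieldType) (l : lmodType K) (br : l -> l -> l) (LA : lie_algebra br).

Definition even_grading (a : bool) (x : l) : Prop := if a then x = 0 else True.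

Let br0l y : br 0 y = 0.
Proof. by have := lie_linear_l LA (-1) 0 0 y; rewrite scaler0 addr0 scaleN1r addNr. Qed.
Let br0r x : br x 0 = 0.
Proof. by have := lie_linear_r LA (-1) x 0 0; rewrite scaler0 addr0 scaleN1r addNr. Qed.

Lemma lie_anti x y : br x y = - br y x.
Proof.
have brl u v w : br (u + v) w = br u w + br v w.
  by have := lie_linear_l LA 1 u v w; rewrite !scale1r.
have brr u v w : br u (v + w) = br u v + br u w.
  by have := lie_linear_r LA 1 u v w; rewrite !scale1r.
apply/eqP; rewrite -addr_eq0; have := lie_alt LA (x + y).
by rewrite brl !brr !(lie_alt LA) addr0 add0r => ->.
Qed.

Lemma lie_superalgebra_even : lie_superalgebra even_grading br (fun _ => 0).
Proof.
split.
- split=> [[]//|[] //= c x y -> ->|x|x _ //]; first by rewrite scaler0 addr0.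
  by exists x, 0; rewrite addr0.
- exact: lie_linear_l.
- exact: lie_linear_r.
- by move=> [] [] x y //= => [-> _|_ ->]; rewrite ?br0l ?br0r.
- move=> [] [] x y //=; rewrite ?expr0 ?scale1r => hx hy; last exact: lie_anti.
  + by rewrite hx br0l br0r scaler0 oppr0.
  + by rewrite hx br0l br0r oppr0.
  by rewrite hy br0l br0r oppr0.
- move=> [] [] x y z //=; rewrite ?expr0 ?scale1r => hx hy; last exact: (lie_jacobi LA).
  + by rewrite hx hy !br0l scaler0 addr0.
  + by rewrite hx !br0l br0r addr0.
  by rewrite hy !br0l !br0r br0l addr0.
- by move=> x _; apply: lie_alt.
- by move=> y ->; rewrite br0l.
- by [].
- by move=> a y _; rewrite scaler0.
- by move=> x y -> ->; rewrite br0l !addr0.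
by move=> y z ->; rewrite !br0l.
Qed.

Context (S : nmodType).
Local Notation g := (current S l).
Local Notation ceven := (@cpar K S l even_grading).

Lemma ceven_odd u : ceven true u -> u = 0.
Proof. by move=> h; apply/malgP => r; rewrite mcoeff0; apply: h. Qed.

(** Odd elements are 0, so the square condition is trivial and no sign matters: both universal
    properties range over the same maps. *)
Lemma lie_super_rep_even (A : algType K) (f : g -> A) :
  lie_super_rep ceven (@cbr K S l br) (@csq K S l br (fun _ => 0)) f <->
  lie_rep (@cbr K S l br) f.
Proof.
split=> [[lf fbr _]|[lf fbr]].
  split=> // x y; have := fbr false false x y (fun _ => Logic.I) (fun _ => Logic.I).
  by rewrite expr0 mul1r.
have f0 : f 0 = 0 by have := lf (-1) 0 0; rewrite scaler0 addr0 scaleN1r addNr.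
have cbr0l y : @cbr K S l br 0 y = 0 by rewrite /cbr msupp0 big_seq_fset0.
have cbr0r y : @cbr K S l br y 0 = 0.
  by rewrite /cbr big1 // => r _; rewrite msupp0 big_seq_fset0.
split=> //.
  move=> [] [] x y; last by move=> _ _; rewrite expr0 mul1r.
  - by move=> /ceven_odd -> _; rewrite cbr0l f0 mul0r !mulr0 subrr.
  - by move=> /ceven_odd -> _; rewrite cbr0l f0 mul0r !mulr0 subrr.
  by move=> _ /ceven_odd ->; rewrite cbr0r f0 !(mulr0, mul0r) subrr.
move=> y /ceven_odd ->; rewrite f0 expr0n /= /csq msupp0 big_seq_fset0 add0r big_ord0.
exact: f0.
Qed.

End TrivialGrading.

Theorem theorem2 (K : closedFieldType) (p : nat) (hp : p \in [pchar K])
    (k : expo_kind) (l : lmodType K) (br : l -> l -> l) (pm : l -> l)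
    (I : choiceType) (e : I -> l) (J : {pred I})
    (he : basis_on e predT (fun _ => True))
    (hJ : basis_on e J (lie_center br))
    (pg : current (expo k) l -> current (expo k) l)
    (U : algType K) (iota : current (expo k) l -> U) :
  (lie_algebra br ->
   restricted br p (fun _ => True) pm ->
   restricted (@cbr K (expo k) l br) p (fun _ => True) pg ->
   (forall i r, pg << e i *g r >> = << pm (e i) *g r *+ p >>) ->
   enveloping_algebra (@cbr K (expo k) l br) iota ->
   (forall z, center z <->
      subalg (fun u =>
        (exists2 jr : I * expo k, jr.1 \in J & u = iota << e jr.1 *g jr.2 >>) \/
        p_center p (fun _ => True) pg iota u) z) /\
   freely_generated (@center K U) (predT : {pred I * expo k})
     (fun ir => let y : current (expo k) l := << e ir.1 *g ir.2 >> in
        if ir.1 \in J then iota y else iota y ^+ p - iota (pg y)))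
  /\
  (forall (par : bool -> l -> Prop) (sq : l -> l) (I0 I1 : {pred I}),
   lie_superalgebra par br sq ->
   restricted br p (par false) pm ->
   (forall z, lie_center br z -> par false z) ->
   (forall i, (i \in I1) = (i \notin I0)) ->
   basis_on e I0 (par false) ->
   basis_on e I1 (par true) ->
   {subset J <= I0} ->
   restricted (@cbr K (expo k) l br) p (@cpar K (expo k) l par false) pg ->
   (forall i r, i \in I0 -> pg << e i *g r >> = << pm (e i) *g r *+ p >>) ->
   enveloping_superalgebra (@cpar K (expo k) l par) (@cbr K (expo k) l br)
     (@csq K (expo k) l br sq) iota ->
   (forall z, super_center iota (@cpar K (expo k) l par) z <->
      subalg (fun u =>
        (exists2 jr : I * expo k, jr.1 \in J & u = iota << e jr.1 *g jr.2 >>) \/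
        p_center p (@cpar K (expo k) l par false) pg iota u) z) /\
   freely_generated (super_center iota (@cpar K (expo k) l par))
     [pred ir : I * expo k | ir.1 \in I0]
     (fun ir => let y : current (expo k) l := << e ir.1 *g ir.2 >> in
        if ir.1 \in J then iota y else iota y ^+ p - iota (pg y))).
Proof.
split=> [LA _ hpg _ HU|par sq I0 I1 LS _ _ I1E b0 b1 JI0 hpg _ HU]; last first.
  by have [] := super_center_current hp he hJ LS I1E b0 b1 JI0 hpg HU.
pose par := @even_grading K l.
have LS := lie_superalgebra_even LA.
(* Every index counts as even and none as odd. *)
have I1E i : (i \in (pred0 : {pred I})) = (i \notin (predT : {pred I})) by [].
have b0 : basis_on e predT (par false) by exact: he.
have b1 : basis_on e (pred0 : {pred I}) (par true).
  split=> // [[|i s] _ h d _ j // |v ->]; first by have := h i (mem_head _ _).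
  by exists [::], (fun=> 0); rewrite big_nil.
have hpg' : restricted (@cbr K (expo k) l br) p (cpar par false) pg.
  by case: hpg => h1 h2 h3 h4; split=> // *; [apply: h2|apply: h3|apply: h4].
have HU' : enveloping_superalgebra (cpar par) (@cbr K (expo k) l br)
    (@csq K (expo k) l br (fun _ => 0)) iota.
  have [rep univ] := HU; split; first exact: (lie_super_rep_even br iota).2.
  by move=> A f /(lie_super_rep_even br f).1; apply: univ.
have [h1 [h2 h3 h4] h5] := super_center_current hp he hJ LS I1E b0 b1 (fun _ _ =>
  isT) hpg' HU'.
have center_iff z : super_center iota (cpar par) z <-> center z by apply: h5.
have gen_iff (G G' : U -> Prop) z :
  (forall u, G u <-> G' u) -> subalg G z <-> subalg G' z.
  move=> GG'; split; elim=> {z} [u /GG' hu||*|*];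
    by [exact: SubalgGen|exact: SubalgOne|exact: SubalgLinear|exact: SubalgMul].
have pc_iff u : p_center p (cpar par false) pg iota u <-> p_center p (fun _ =>
  True) pg iota u.
  by apply: gen_iff => v; split=> -[y _ ->]; exists y.
split=> [z|]; last split=> //.
- rewrite -center_iff h1; apply: gen_iff => u; split=> -[h|/pc_iff h]; by [left|right].
- by move=> z; rewrite -center_iff h3.
Qed.
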